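(* There is a polynomial-time algorithm that, given a finite simple graph $G$ of maximum degree at most $3$, outputs an induced matching $M$ in $G$ together with a feasible solution $(y_e)_{e\in E(G)}$ of the linear program $(D)$ for $G$ such that $$|M| \geq \frac{3}{7}\sum_{e\in E(G)} y_e.$$
   Context: A set $M$ of edges of a graph $G$ is an induced matching if no two edges of $M$ share a vertex or are joined by an edge of $G$. For a vertex $u$, $\delta_G(u)$ is the set of edges incident with $u$; for an edge $uv$, $\delta_G(uv)=\delta_G(u)\cup\delta_G(v)$. The linear program $(D)$ for $G$ is: minimize $\sum_{e\in E(G)} y_e$ subject to $\sum_{f\in\delta_G(e)} y_f\ge 1$ for every $e\in E(G)$ and $y_e\ge 0$ for every $e\in E(G)$. *)

(* Defs.v *)
From mathcomp Require Import all_boot all_order all_algebra.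
Set Implicit Arguments. Unset Strict Implicit. Unset Printing Implicit Defensive.
Import Order.TTheory GRing.Theory Num.Theory.

(* Model of computation: structured programs for a random-access machine.     *)
(* The store consists of arrays of natural numbers, named by constants; a     *)
(* program mentions finitely many of them, so that they can be interleaved in *)
(* the single memory of a RAM.  A scalar variable is cell 0 of an array.      *)
(* Each elementary operation costs 1.  There is no multiplication, so the bit *)
(* length of the largest stored number grows by at most a constant per step,  *)
(* and this unit-cost time is polynomially related to Turing machine time.    *)

Inductive expr :=
  | Const of nat
  | Get of nat & expr            (* Get a i is the content of cell i of a     *)
  | Add of expr & expr
  | Sub of expr & expr.          (* truncated at 0                            *)

Inductive cmd :=
  | Skip
  | Set_ of nat & expr & expr    (* Set_ a i e stores e in cell i of a        *)
  | Seq of cmd & cmd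
  | If of expr & cmd & cmd       (* a nonzero value counts as true            *)
  | While of expr & cmd.

Definition store := nat -> nat -> nat.

Definition update (s : store) (a i v : nat) : store :=
  fun b j => if (b == a) && (j == i) then v else s b j.

Fixpoint eval (s : store) (e : expr) : nat :=
  match e with
  | Const n => n
  | Get a i => s a (eval s i)
  | Add e1 e2 => eval s e1 + eval s e2
  | Sub e1 e2 => eval s e1 - eval s e2
  end.

Fixpoint cost (e : expr) : nat :=
  match e with
  | Const _ => 1
  | Get _ i => (cost i).+1
  | Add e1 e2 | Sub e1 e2 => (cost e1 + cost e2).+1
  end.

(* exec c s t s' : started in store s, the program c halts in store s' after  *)
(* exactly t elementary operations.                                           *)
Inductive exec : cmd -> store -> nat -> store -> Prop :=
  | exec_skip s : exec Skip s 1 s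
  | exec_set a i e s :
      exec (Set_ a i e) s (cost i + cost e).+1 (update s a (eval s i) (eval s e))
  | exec_seq c1 c2 s1 s2 s3 t1 t2 :
      exec c1 s1 t1 s2 -> exec c2 s2 t2 s3 -> exec (Seq c1 c2) s1 (t1 + t2) s3
  | exec_if_true e c1 c2 s s' t :
      eval s e != 0 -> exec c1 s t s' -> exec (If e c1 c2) s ((cost e).+1 + t) s'
  | exec_if_false e c1 c2 s s' t :
      eval s e = 0 -> exec c2 s t s' -> exec (If e c1 c2) s ((cost e).+1 + t) s'
  | exec_while_true e c s1 s2 s3 t1 t2 :
      eval s1 e != 0 -> exec c s1 t1 s2 -> exec (While e c) s2 t2 s3 ->
      exec (While e c) s1 ((cost e).+1 + t1 + t2) s3
  | exec_while_false e c s :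
      eval s e = 0 -> exec (While e c) s (cost e).+1 s.

Lemma exec_det c s t1 s1 t2 s2 :
  exec c s t1 s1 -> exec c s t2 s2 -> t1 = t2 /\ s1 = s2.
Proof.
move=> ex1; elim: ex1 t2 s2 => {c s t1 s1}.
- by move=> s t2 s2 ex; inversion ex.
- by move=> a i e s t2 s2 ex; inversion ex.
- move=> c1 c2 s1 s2 s3 t1 t2 _ IH1 _ IH2 t s ex.
  inversion ex; subst.
  match goal with H : exec c1 _ _ _ |- _ => case: (IH1 _ _ H) => ? ? end; subst.
  by match goal with H : exec c2 _ _ _ |- _ => case: (IH2 _ _ H) => -> -> end.
- move=> e c1 c2 s s' t ne _ IH t2 s2 ex.
  inversion ex; subst.
    by match goal with H : exec _ _ _ _, K : exec c1 _ _ _ |- _ =>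
      case: (IH _ _ K) => -> -> end.
  by match goal with H : eval _ _ = 0 |- _ => rewrite H in ne end.
- move=> e c1 c2 s s' t ez _ IH t2 s2 ex.
  inversion ex; subst.
    by match goal with H : is_true (eval _ _ != 0) |- _ => rewrite ez in H end.
  by match goal with K : exec c2 _ _ _ |- _ => case: (IH _ _ K) => -> -> end.
- move=> e c s1 s2 s3 t1 t2 ne _ IH1 _ IH2 t s ex.
  inversion ex; subst.
    match goal with K : exec c _ _ _ |- _ => case: (IH1 _ _ K) => ? ? end; subst.
    by match goal with K : exec (While e c) _ _ _ |- _ =>
      case: (IH2 _ _ K) => -> -> end.
  by match goal with H : eval _ _ = 0 |- _ => rewrite H in ne end.
- move=> e c s ez t2 s2 ex.
  inversion ex; subst; last by [].
  by match goal with H : is_true (eval _ _ != 0) |- _ => rewrite ez in H end.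
Qed.

(* A word w is given in array 0, and read from array 1, as its length in      *)
(* cell 0 followed by its entries; initially all other cells contain 0.       *)
Definition input (w : seq nat) : store :=
  fun a i => if a == 0 then nth 0 (size w :: w) i else 0.

Definition output (s : store) : seq nat := mkseq (fun i => s 1 i.+1) (s 1 0).

(* The total number of binary digits (with 0 written as one digit).           *)
Definition bitsize (w : seq nat) : nat := \sum_(x <- w) (trunc_log 2 x).+1.

Record sgraph := SGraph {
  order : nat;
  adj : rel 'I_order;
  adj_sym : symmetric adj;
  adj_irrefl : irreflexive adj }.

Notation vertex G := 'I_(order G).

Section Graph.
Variable G : sgraph.
Implicit Types (u v : vertex G) (e f : {set vertex G}).

Definition edges : {set {set vertex G}} :=
  [set e | [exists u, exists v, adj u v && (e == [set u; v])]].

Definition max_degree : nat := \max_(u : vertex G) #|[set v | adj u v]|.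

Definition induced_matching (M : {set {set vertex G}}) : Prop :=
  M \subset edges /\
  forall e f, e \in M -> f \in M -> e != f ->
    [disjoint e & f] /\ forall u v, u \in e -> v \in f -> ~~ adj u v.

Definition vdelta u : {set {set vertex G}} := [set e in edges | u \in e].

Definition edelta e : {set {set vertex G}} := \bigcup_(u in e) vdelta u.

(* Only the values of y on edges matter.                                      *)
Definition feasible_D (y : {set vertex G} -> rat) : Prop :=
  (forall e, e \in edges -> (1 <= \sum_(f in edelta e) y f)%R) /\
  (forall e, e \in edges -> (0 <= y e)%R).

Definition encode_graph : seq nat :=
  order G :: [seq nat_of_bool (adj u v) | u <- enum 'I_(order G),
                                         v <- enum 'I_(order G)].

(* The word w consists of three n x n matrices, stored row by row: the 0/1    *)
(* matrix of M, then numerators and denominators of the values of y.          *)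
Definition encodes_solution (w : seq nat)
    (M : {set {set vertex G}}) (y : {set vertex G} -> rat) : Prop :=
  let n := order G in
  let entry k u v := nth 0 w (k * n ^ 2 + u * n + v) in
  [/\ size w = 3 * n ^ 2,
      forall u v, entry 0 u v = nat_of_bool ([set u; v] \in M)
    & forall u v, [set u; v] \in edges ->
        entry 2 u v != 0 /\
        y [set u; v] = ((entry 1 u v)%:R / (entry 2 u v)%:R)%R].

End Graph.

(* Main.v *)
(* A primal-dual algorithm in two phases, both deleting N[u] :|: N[v] whenever*)

(* Why 7/3: let M1 and Y be the matching and the weight-1 edges after the first phase, M the final
   matching. In units of 1/150 the dual solution costs at most 150|Y| + pot(S0), by [value_sum].
   Since |Y| <= 2|M1|, and each of the |M| - |M1| later edges lowers the potential by at most 350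
   down to 0, the cost is at most 300|M1| + 350(|M| - |M1|) <= 350|M|, and 350/150 = 7/3.

   Feasibility ([value_cover]): an edge outside S0 meets an edge of Y ([touching]); an edge inside
   S0 collects 1/2 at each end, because S0 has no leaf ([leaf_reducible]).

   Cheap edges ([good_exists]): deleting vertices forfeits their potential, and a survivor loses a
   fixed amount per edge to a deleted vertex plus a surcharge if it becomes isolated. Double
   counting charges these losses to the edges leaving the deleted set ([pot_drop], [sum_dg]). At a
   leaf the bound 350 is immediate. With minimum degree 2 it is kept by the absence of 4-cycles
   through vertices of degree 2 in S0 ([c4_reducible]) and by a switch along a 5-cycle; in the cubic
   case, by a switch to a survivor that would be isolated.

   Complexity: the algorithm is written with for loops of n iterations only, so any such program
   compiles to polynomial time ([compile]). Greedy repetition becomes n rounds of exhaustive search,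
   enough because every success removes a vertex ([run_rounds]). *)
(* uv is put into M.  The first phase takes uv only if all deleted edges meet *)
(* one of two edges, to which it gives weight 1; it thus pays at most 2 per   *)
(* edge of M, and stops at a graph S0 without leaves and without vertices of  *)
(* degree 2 on a 4-cycle.  On S0 set y_uv = a_u + a_v with a = 1/5, 1/10 at   *)
(* vertices of degree 2, 3: each end of an edge contributes at least 1/2 to   *)
(* its constraint, and the total weight is (4 n_2 + 3 n_3) / 10.  This is     *)
(* 1/150 of the potential [pot], and the second phase takes edges uv whose    *)
(* deletion costs at most 350 = 150 * 7/3 units of potential.  Such an edge   *)
(* exists as long as there is an edge at all: one takes a leaf, or else a     *)
(* vertex of degree 2, or else any vertex, and switches to a neighbouring edge*)
(* if too many boundary vertices get isolated.                                *)
Require Import Defs.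
From mathcomp Require Import all_boot all_order all_algebra zify ring.
From Stdlib Require Import FunctionalExtensionality.
Set Implicit Arguments. Unset Strict Implicit. Unset Printing Implicit Defensive.
Import Order.TTheory GRing.Theory Num.Theory.

(** * A loop language and its compilation *)

(* Variables are de Bruijn levels; [TSum t] sums [t] over the values          *)
(* 0, ..., n - 1 of a new variable, where n is the content of cell 1 of       *)
(* array 0, i.e. the order of the input graph.                                *)
Inductive term :=
  | TC of nat
  | TV of nat
  | TGet of nat & term
  | TAdd of term & term
  | TSub of term & term
  | TIf of term & term & term
  | TSum of term.

Inductive prog :=
  | PSet of nat & term & term
  | PSeq of prog & prog
  | PIf of term & prog
  | PFor of prog.

Fixpoint den (s : store) (env : seq nat) (t : term) : nat :=
  match t with
  | TC c => c
  | TV i => nth 0 env i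
  | TGet a t => s a (den s env t)
  | TAdd t1 t2 => den s env t1 + den s env t2
  | TSub t1 t2 => den s env t1 - den s env t2
  | TIf t t1 t2 => if den s env t != 0 then den s env t1 else den s env t2
  | TSum t => \sum_(0 <= i < s 0 1) den s (rcons env i) t
  end.

Fixpoint run (s : store) (env : seq nat) (p : prog) : store :=
  match p with
  | PSet a i t => update s a (den s env i) (den s env t)
  | PSeq p q => run (run s env p) env q
  | PIf t p => if den s env t != 0 then run s env p else s
  | PFor p => foldl (fun s i => run s (rcons env i) p) s (iota 0 (s 0 1))
  end.

(* The compiled code keeps loop variables in array 2 and intermediate results *)
(* in array 3, as stacks.                                                     *)
Definition scratch (a : nat) := (a == 2) || (a == 3).

Fixpoint wft (d : nat) (t : term) : bool :=
  match t with
  | TC _ => true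
  | TV i => i < d
  | TGet a t => ~~ scratch a && wft d t
  | TAdd t1 t2 | TSub t1 t2 => wft d t1 && wft d t2
  | TIf t t1 t2 => [&& wft d t, wft d t1 & wft d t2]
  | TSum t => wft d.+1 t
  end.

Fixpoint wfp (d : nat) (p : prog) : bool :=
  match p with
  | PSet a i t => [&& a != 0, ~~ scratch a, wft d i & wft d t]
  | PSeq p q => wfp d p && wfp d q
  | PIf t p => wft d t && wfp d p
  | PFor p => wfp d.+1 p
  end.

Notation cell a k := (Get a (Const k)).

Definition loop (d : nat) (c : cmd) : cmd :=
  Seq (Set_ 2 (Const d) (Const 0))
    (While (Defs.Sub (cell 0 1) (cell 2 d))
      (Seq c (Set_ 2 (Const d) (Add (cell 2 d) (Const 1))))).

Fixpoint compt (d k : nat) (t : term) : cmd :=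
  match t with
  | TC c => Set_ 3 (Const k) (Const c)
  | TV i => Set_ 3 (Const k) (cell 2 i)
  | TGet a t => Seq (compt d k t) (Set_ 3 (Const k) (Get a (cell 3 k)))
  | TAdd t1 t2 =>
      Seq (compt d k t1) (Seq (compt d k.+1 t2)
        (Set_ 3 (Const k) (Add (cell 3 k) (cell 3 k.+1))))
  | TSub t1 t2 =>
      Seq (compt d k t1) (Seq (compt d k.+1 t2)
        (Set_ 3 (Const k) (Defs.Sub (cell 3 k) (cell 3 k.+1))))
  | TIf t t1 t2 =>
      Seq (compt d k t) (If (cell 3 k) (compt d k t1) (compt d k t2))
  | TSum t =>
      Seq (Set_ 3 (Const k) (Const 0))
        (loop d (Seq (compt d.+1 k.+1 t)
          (Set_ 3 (Const k) (Add (cell 3 k) (cell 3 k.+1)))))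
  end.

Fixpoint compp (d : nat) (p : prog) : cmd :=
  match p with
  | PSet a i t =>
      Seq (compt d 0 i) (Seq (compt d 1 t) (Set_ a (cell 3 0) (cell 3 1)))
  | PSeq p q => Seq (compp d p) (compp d q)
  | PIf t p => Seq (compt d 0 t) (If (cell 3 0) (compp d p) Skip)
  | PFor p => loop d (compp d.+1 p)
  end.

(** * Running time and correctness of compiled code *)

Fixpoint timet (t : term) (n : nat) : nat :=
  match t with
  | TC _ | TV _ => 9
  | TGet _ t => timet t n + 9
  | TAdd t1 t2 | TSub t1 t2 => timet t1 n + timet t2 n + 9
  | TIf t t1 t2 => timet t n + timet t1 n + timet t2 n + 9
  | TSum t => n * (timet t n + 20) + 20
  end.

Fixpoint timep (p : prog) (n : nat) : nat :=
  match p with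
  | PSet _ i t => timet i n + timet t n + 9
  | PSeq p q => timep p n + timep q n
  | PIf t p => timet t n + timep p n + 9
  | PFor p => n * (timep p n + 20) + 20
  end.

(** The loop language knows nothing of the scratch arrays; blanking them allows equality of stores
    as the correctness statement. *)
Definition data (s : store) : store := fun a i => if scratch a then 0 else s a i.

Lemma data_id s a i : ~~ scratch a -> data s a i = s a i.
Proof. by rewrite /data => /negbTE ->. Qed.

Lemma data_scratch s a i v : scratch a -> data (update s a i v) = data s.
Proof.
move=> sa; do 2!apply: functional_extensionality => ?; rewrite /data /update.
by case: ifP => // nsb; case: eqP => //= eb; rewrite eb sa in nsb.
Qed.

Lemma data_update s a i v :
  ~~ scratch a -> data (update s a i v) = update (data s) a i v.
Proof.
move=> sa; do 2!apply: functional_extensionality => ?; rewrite /data /update.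
by case: ifP => // sb; case: eqP => //= eb; rewrite -eb sb in sa.
Qed.

(** An iteration adds 6 steps for the guard and 6 for the increment, hence 12; initialisation and
    the final guard take 3 + 6 = 9. The invariant includes that the counter has been set, so it is
    asked for after the update of array 2. *)
Lemma loop_exec d c n T (I : nat -> store -> Prop) :
    (forall i s, I i s -> s 0 1 = n /\ s 2 d = i) ->
    (forall i s, i < n -> I i s ->
       exists t s', [/\ exec c s t s', t <= T, s' 2 d = i
                      & I i.+1 (update s' 2 d i.+1)]) ->
  forall s, I 0 (update s 2 d 0) ->
  exists t s', [/\ exec (loop d c) s t s', t <= n * (T + 12) + 9 & I n s'].
Proof.
move=> Idef Istep s I0.
pose w := While (Defs.Sub (cell 0 1) (cell 2 d))
      (Seq c (Set_ 2 (Const d) (Add (cell 2 d) (Const 1)))).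
have W m : forall i s, m + i = n -> I i s ->
    exists t s', [/\ exec w s t s', t <= m * (T + 12) + 6 & I n s'].
  elim: m => [|m IHm] i s1 mi Is.
    have [n1 i1] := Idef _ _ Is.
    exists 6, s1; split=> //; last by rewrite -mi.
    by apply: exec_while_false; rewrite /= n1 i1; lia.
  have [n1 i1] := Idef _ _ Is.
  have lin : i < n by lia.
  have [t1 [s2 [ex1 le1 d2 Is2]]] := Istep _ _ lin Is.
  have mi' : m + i.+1 = n by lia.
  have [t3 [s3 [ex3 le3 Is3]]] := IHm _ _ mi' Is2.
  exists (6 + (t1 + 5.+1) + t3), s3; split=> //; last by nia.
  apply: (exec_while_true (s2 := update s2 2 d i.+1)) => //.
    by rewrite /= n1 i1; lia.
  apply: (exec_seq ex1).
  have := exec_set 2 (Const d) (Add (cell 2 d) (Const 1)) s2.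
  by rewrite /= d2 !addn1.
have [t [s' [ex le Is']]] := W n 0 _ (addn0 n) I0.
exists (3 + t), s'; split=> //; last by lia.
exact: (exec_seq (exec_set 2 (Const d) (Const 0) s)).
Qed.

Definition env_ok (s : store) (env : seq nat) :=
  forall i, i < size env -> s 2 i = nth 0 env i.

Lemma env_ok_update s env a i v :
  a != 2 -> env_ok s env -> env_ok (update s a i v) env.
Proof. by move=> na se j /se <-; rewrite /update eq_sym (negbTE na). Qed.

Lemma env_ok_rcons s env i :
  env_ok s env -> s 2 (size env) = i -> env_ok s (rcons env i).
Proof.
move=> se si j; rewrite size_rcons nth_rcons ltnS leq_eqVlt => /orP[/eqP->|ltj].
  by rewrite ltnn eqxx si.
by rewrite ltj se.
Qed.

Lemma env_ok_belast s env i : env_ok s (rcons env i) -> env_ok s env.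
Proof.
move=> se j ltj; have := se j.
by rewrite size_rcons nth_rcons ltj; apply; apply: leqW.
Qed.

Lemma env_ok_last s env i : env_ok s (rcons env i) -> s 2 (size env) = i.
Proof. by move=> se; have := se (size env); rewrite size_rcons nth_rcons ltnn eqxx; apply. Qed.

(** The cells of array 3 below [k] must survive because they hold operands that were evaluated
    earlier. *)
Lemma compt_exec t d k s env :
    wft d t -> size env = d -> env_ok s env ->
  exists T s', [/\ exec (compt d k t) s T s', T <= timet t (s 0 1),
    s' 3 k = den (data s) env t
    & [/\ data s' = data s, env_ok s' env & forall j, j < k -> s' 3 j = s 3 j]].
Proof.
have keep (s' s'' : store) k' v : data s' = data s'' ->
    (forall j, j < k' -> s' 3 j = s'' 3 j) ->
    data (update s' 3 k' v) = data s'' /\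
    (forall j, j < k' -> update s' 3 k' v 3 j = s'' 3 j).
  move=> ds' js'; split=> [|j ltj]; first by rewrite data_scratch.
  by rewrite /update eqxx (ltn_eqF ltj) js'.
(* Addition and subtraction compile alike; one argument with an abstract operation serves both. *)
have bin (op : nat -> nat -> nat) (eop : expr -> expr -> expr) t1 t2 :
    (forall s e1 e2, eval s (eop e1 e2) = op (eval s e1) (eval s e2)) ->
    (forall e1 e2, cost (eop e1 e2) = (cost e1 + cost e2).+1) ->
    (forall d k s env, wft d t1 -> size env = d -> env_ok s env ->
      exists T s', [/\ exec (compt d k t1) s T s', T <= timet t1 (s 0 1),
      s' 3 k = den (data s) env t1
      & [/\ data s' = data s, env_ok s' env & forall j, j < k -> s' 3 j = s 3 j]]) ->
    (forall d k s env, wft d t2 -> size env = d -> env_ok s env ->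
      exists T s', [/\ exec (compt d k t2) s T s', T <= timet t2 (s 0 1),
      s' 3 k = den (data s) env t2
      & [/\ data s' = data s, env_ok s' env & forall j, j < k -> s' 3 j = s 3 j]]) ->
    forall d k s env, wft d t1 && wft d t2 -> size env = d -> env_ok s env ->
    exists T s', [/\ exec (Seq (compt d k t1) (Seq (compt d k.+1 t2)
          (Set_ 3 (Const k) (eop (cell 3 k) (cell 3 k.+1))))) s T s',
      T <= timet t1 (s 0 1) + timet t2 (s 0 1) + 9,
      s' 3 k = op (den (data s) env t1) (den (data s) env t2)
      & [/\ data s' = data s, env_ok s' env & forall j, j < k -> s' 3 j = s 3 j]].
  move=> eopE eopC IH1 IH2 {}d {}k {}s {}env /andP[w1 w2] se ok.
  have [T1 [s1 [ex1 le1 r1 [d1 o1 k1]]]] := IH1 d k s env w1 se ok.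
  have [T2 [s2 [ex2 le2 r2 [d2 o2 k2]]]] := IH2 d k.+1 s1 env w2 se o1.
  set v := op _ _.
  exists (T1 + (T2 + 7)), (update s2 3 k v); split.
  - apply: (exec_seq ex1); apply: (exec_seq ex2).
    have := exec_set 3 (Const k) (eop (cell 3 k) (cell 3 k.+1)) s2.
    by rewrite eopE eopC /= r2 k2 // r1 d1.
  - have e01 : s1 0 1 = s 0 1 by rewrite -(data_id s1) // d1 data_id.
    by rewrite e01 in le2; lia.
  - by rewrite /update !eqxx.
  have [] := keep s2 s k v.
  - by rewrite d2 d1.
  - by move=> j ltj; rewrite k2 ?k1 // ltnW.
  by split=> //; apply: env_ok_update.
elim: t d k s env => [c|i|a t IH|t1 IH1 t2 IH2|t1 IH1 t2 IH2|t IH t1 IH1 t2 IH2|t IH]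
  d k s env /=.
- move=> _ _ ok; exists 3, (update s 3 k c); split=> //.
  + exact: (exec_set 3 (Const k) (Const c)).
  + by rewrite /update !eqxx.
  by have [] := keep s s k c erefl; split=> //; apply: env_ok_update.
- move=> lti se ok; exists 4, (update s 3 k (s 2 i)); split=> //.
  + exact: (exec_set 3 (Const k) (cell 2 i)).
  + by rewrite /update !eqxx ok // se.
  by have [] := keep s s k (s 2 i) erefl; split=> //; apply: env_ok_update.
- move=> /andP[na w] se ok.
  have [T1 [s1 [ex1 le1 r1 [d1 o1 k1]]]] := IH d k s env w se ok.
  set v := data s a _.
  exists (T1 + 5), (update s1 3 k v); split=> //.
  + apply: (exec_seq ex1).
    have := exec_set 3 (Const k) (Get a (cell 3 k)) s1.
    by rewrite /= r1 -(data_id s1) // d1.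
  + by lia.
  + by rewrite /update !eqxx.
  by have [] := keep s1 s k v d1 k1; split=> //; apply: env_ok_update.
- exact: bin IH1 IH2 d k s env.
- exact: bin IH1 IH2 d k s env.
- move=> /and3P[w w1 w2] se ok.
  have [T1 [s1 [ex1 le1 r1 [d1 o1 k1]]]] := IH d k s env w se ok.
  have e01 : s1 0 1 = s 0 1 by rewrite -(data_id s1) // d1 data_id.
  have [nz|/negbNE/eqP z] := boolP (den (data s) env t != 0).
  + have [T2 [s2 [ex2 le2 r2 [d2 o2 k2]]]] := IH1 d k s1 env w1 se o1.
    exists (T1 + (3 + T2)), s2; split; rewrite -?d1 //.
    * by apply: (exec_seq ex1); apply: exec_if_true => //=; rewrite r1.
    * by rewrite e01 in le2; lia.
    by split=> // j ltj; rewrite k2 ?k1.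
  + have [T2 [s2 [ex2 le2 r2 [d2 o2 k2]]]] := IH2 d k s1 env w2 se o1.
    exists (T1 + (3 + T2)), s2; split; rewrite -?d1 //.
    * by apply: (exec_seq ex1); apply: exec_if_false => //=; rewrite r1.
    * by rewrite e01 in le2; lia.
    by split=> // j ltj; rewrite k2 ?k1.
move=> w se ok.
pose n := s 0 1.
pose I i (s' : store) := [/\ data s' = data s, env_ok s' (rcons env i),
  s' 3 k = \sum_(0 <= j < i) den (data s) (rcons env j) t
  & forall j, j < k -> s' 3 j = s 3 j].
have [|||T [s' [ex le [dI oI kI jI]]]] := @loop_exec d
  (Seq (compt d.+1 k.+1 t) (Set_ 3 (Const k) (Add (cell 3 k) (cell 3 k.+1))))
  n (timet t n + 7) I _ _ (update s 3 k 0).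
- move=> i s1 [d1 /env_ok_last o1 _ _]; rewrite -se; split=> //.
  by rewrite -(data_id s1) // d1 data_id.
- move=> i s1 lti [d1 o1 k1 j1].
  have se' : size (rcons env i) = d.+1 by rewrite size_rcons se.
  have [T2 [s2 [ex2 le2 r2 [d2 o2 k2]]]] := IH d.+1 k.+1 s1 (rcons env i) w se' o1.
  set v := \sum_(0 <= j < i.+1) den (data s) (rcons env j) t.
  exists (T2 + 7), (update s2 3 k v); split.
  + apply: (exec_seq ex2).
    have := exec_set 3 (Const k) (Add (cell 3 k) (cell 3 k.+1)) s2.
    by rewrite /= r2 k2 // k1 d1 /v big_nat_recr.
  + have e01 : s1 0 1 = s 0 1 by rewrite -(data_id s1) // d1 data_id.
    by rewrite e01 in le2; rewrite /n; lia.
  + by rewrite /update /= -se (env_ok_last o2).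
  split.
  + by rewrite !data_scratch // d2.
  + apply: env_ok_rcons; last by rewrite /update se !eqxx.
    move=> j ltj; rewrite /update /= -se (ltn_eqF ltj) /=.
    by apply: (env_ok_belast o2).
  + by rewrite /update /= !eqxx.
  by move=> j ltj; rewrite /update /= (ltn_eqF ltj) k2 ?j1 // ltnW.
- split.
  + by rewrite !data_scratch.
  + apply: env_ok_rcons; last by rewrite /update se !eqxx.
    by move=> j ltj; rewrite /update /= -se (ltn_eqF ltj) ok.
  + by rewrite /update /= eqxx big_geq.
  by move=> j ltj; rewrite /update /= (ltn_eqF ltj).
exists (3 + T), s'; split=> //.
- exact: (exec_seq (exec_set 3 (Const k) (Const 0) s)).
- by move: le; rewrite /n; set m := s 0 1; nia.
by split=> //; apply: env_ok_belast oI.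
Qed.

Lemma iota0S i : iota 0 i.+1 = rcons (iota 0 i) i.
Proof. by rewrite -addn1 iotaD cats1. Qed.

(** Well-formed programs never write to array 0, so the loop bound [s 0 1] is the same at all times
    and [timep] can be evaluated at the initial store. *)
Lemma run_input s env p d : wfp d p -> run s env p 0 = s 0.
Proof.
elim: p d s env => [a i t|p IHp q IHq|t p IH|p IH] d s env /=.
- by case/and4P=> a0 _ _ _; apply: functional_extensionality => j;
    rewrite /update eq_sym (negbTE a0).
- by case/andP=> wp wq; rewrite (IHq d) // (IHp d).
- by case/andP=> _ wp; case: ifP => // _; apply: IH wp.
move=> wp; move: (iota _ _) => l; elim: l s => //= i l IHl s.
by rewrite IHl (IH _ _ _ wp).
Qed.

Lemma compp_exec p d s env :
    wfp d p -> size env = d -> env_ok s env ->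
  exists T s', [/\ exec (compp d p) s T s', T <= timep p (s 0 1),
    data s' = run (data s) env p & env_ok s' env].
Proof.
have d01 s1 : s1 0 1 = data s1 0 1 by rewrite data_id.
elim: p d s env => [a i t|p IHp q IHq|t p IH|p IH] d s env /=.
- move=> /and4P[a0 na wi wt] se ok.
  have [T1 [s1 [ex1 le1 r1 [d1 o1 k1]]]] := @compt_exec i d 0 s env wi se ok.
  have [T2 [s2 [ex2 le2 r2 [d2 o2 k2]]]] := @compt_exec t d 1 s1 env wt se o1.
  rewrite d1 in r2.
  eexists; eexists; split.
  + exact: (exec_seq ex1 (exec_seq ex2 (exec_set a (cell 3 0) (cell 3 1) s2))).
  + by rewrite /= d01 -d1 -d01 in le1 *; lia.
  + by rewrite data_update //= d2 d1 r2 k2 // r1.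
  by apply: env_ok_update => //; move: na; rewrite negb_or => /andP[].
- move=> /andP[wp wq] se ok.
  have [T1 [s1 [ex1 le1 d1 o1]]] := IHp d s env wp se ok.
  have [T2 [s2 [ex2 le2 d2 o2]]] := IHq d s1 env wq se o1.
  exists (T1 + T2), s2; split=> //; last by rewrite d2 d1.
  + exact: exec_seq ex1 ex2.
  by rewrite d01 d1 (run_input _ _ wp) -d01 in le2; lia.
- move=> /andP[wt wp] se ok.
  have [T1 [s1 [ex1 le1 r1 [d1 o1 k1]]]] := @compt_exec t d 0 s env wt se ok.
  case: ifP => [nz|/negbFE/eqP z].
    have [T2 [s2 [ex2 le2 d2 o2]]] := IH d s1 env wp se o1.
    exists (T1 + (3 + T2)), s2; split=> //; last by rewrite d2 d1.
    + by apply: (exec_seq ex1); apply: exec_if_true; rewrite //= r1 nz.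
    by rewrite d01 d1 -d01 in le2; lia.
  exists (T1 + (3 + 1)), s1; split=> //; last by lia.
  apply: (exec_seq ex1); apply: exec_if_false; rewrite //= ?r1 //.
  exact: exec_skip.
move=> wp se ok.
pose n := s 0 1.
pose I i (s' : store) :=
  data s' = foldl (fun s i => run s (rcons env i) p) (data s) (iota 0 i)
  /\ env_ok s' (rcons env i).
have foldl0 i :
    foldl (fun s i => run s (rcons env i) p) (data s) (iota 0 i) 0 = data s 0.
  by elim: i => // i IHi; rewrite iota0S foldl_rcons (run_input _ _ wp).
have [|||T [s' [ex le [dI oI]]]] := @loop_exec d (compp d.+1 p) n (timep p n) I _ _ s.
- move=> i s1 [d1 /env_ok_last o1]; rewrite -se; split=> //.
  by rewrite d01 d1 foldl0 -d01.
- move=> i s1 lti [d1 o1].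
  have se' : size (rcons env i) = d.+1 by rewrite size_rcons se.
  have [T2 [s2 [ex2 le2 d2 o2]]] := IH d.+1 s1 (rcons env i) wp se' o1.
  exists T2, s2; split=> //.
  + by rewrite d01 d1 foldl0 -d01 in le2.
  + by rewrite -se (env_ok_last o2).
  split; first by rewrite data_scratch // d2 d1 iota0S foldl_rcons.
  apply: env_ok_rcons; last by rewrite /update se !eqxx.
  move=> j ltj; rewrite /update /= -se (ltn_eqF ltj) /=.
  exact: (env_ok_belast o2).
- split; first by rewrite data_scratch.
  apply: env_ok_rcons; last by rewrite /update se !eqxx.
  by move=> j ltj; rewrite /update /= -se (ltn_eqF ltj) ok.
exists T, s'; split=> //.
- by move: le; rewrite /n; set m := s 0 1; nia.
exact: env_ok_belast oI.
Qed.

(** * Polynomial bounds *)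

Definition poly_bounded (f : nat -> nat) := exists a k, forall n, f n <= a * n.+1 ^ k.

Lemma poly_const c : poly_bounded (fun=> c).
Proof. by exists c, 0 => n; rewrite expn0 muln1. Qed.

Lemma poly_id : poly_bounded id.
Proof. by exists 1, 1 => n; rewrite expn1 mul1n. Qed.

Lemma poly_add f g :
  poly_bounded f -> poly_bounded g -> poly_bounded (fun n => f n + g n).
Proof.
move=> [a [k fa]] [b [l gb]]; exists (a + b), (maxn k l) => n.
rewrite mulnDl; apply: leq_add.
  by apply: leq_trans (fa n) _; rewrite leq_mul2l leq_pexp2l ?leq_maxl ?orbT.
by apply: leq_trans (gb n) _; rewrite leq_mul2l leq_pexp2l ?leq_maxr ?orbT.
Qed.

Lemma poly_mul f g :
  poly_bounded f -> poly_bounded g -> poly_bounded (fun n => f n * g n).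
Proof.
move=> [a [k fa]] [b [l gb]]; exists (a * b), (k + l) => n.
by rewrite expnD mulnACA leq_mul.
Qed.

Lemma poly_timet t : poly_bounded (timet t).
Proof.
by elim: t => /= *; do ?[exact: poly_const | exact: poly_id | assumption
  | apply: poly_add | apply: poly_mul].
Qed.

Lemma poly_timep p : poly_bounded (timep p).
Proof.
by elim: p => /= *; do ?[exact: poly_const | exact: poly_id | assumption
  | exact: poly_timet | apply: poly_add | apply: poly_mul].
Qed.

Lemma compile p : wfp 0 p -> exists c a k, forall s, data s = s ->
  exists t s', [/\ exec c s t s', t <= a * (s 0 1).+1 ^ k
                 & data s' = run s [::] p].
Proof.
move=> wp; have [a [k le]] := poly_timep p.
exists (compp 0 p), a, k => s ds.
have [//|T [s' [ex leT d' _]]] := @compp_exec p 0 s [::] wp erefl.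
exists T, s'; split=> //; last by rewrite d' ds.
exact: leq_trans leT (le _).
Qed.

(** * Existence of a cheap edge *)

(* [d0] is the degree in S0 and [d] the degree in the current graph.  The     *)
(* value 50 for a degree that dropped from 3 to 2 pays for 4-cycles through   *)
(* such a vertex; S0 itself has no 4-cycle through a vertex of degree 2.      *)
Definition phi (d0 d : nat) : nat :=
  match d with
  | 0 => 0
  | 1 => 42
  | 2 => if d0 == 2 then 60 else 50
  | _ => 45
  end.

Local Ltac phi_lia := rewrite /phi; do ?[case: ifP => _]; lia.

(** The largest loss per edge is that of a leaf, 42. *)
Lemma phi_loss_leaf d0 d o j : d <= 3 -> d = o + j ->
  phi d0 d <= phi d0 o + 42 * j.
Proof.
by case: d => [|[|[|[|d]]]] //; case: o => [|[|[|[|o]]]] //= _ dj; phi_lia.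
Qed.

(** A drop from degree 2 to 1 costs up to 60 - 42 = 18, and a drop from 2 to 0 up to 60 = 2 * 18 +
    24. *)
Lemma phi_loss_deg2 d0 d o j : d <= 3 -> d != 1 -> d = o + j ->
  phi d0 d <= phi d0 o + (18 * j + 24 * ((d == 2) && (o == 0))).
Proof.
by case: d => [|[|[|[|d]]]] //; case: o => [|[|[|[|o]]]] //= _ _ dj; phi_lia.
Qed.

(** A drop from degree 3 to 2 costs nothing, to 1 it costs 45 - 42 = 3, to 0 it costs 45 = 3 * 3 +
    36. *)
Lemma phi_loss_cubic d0 d o j : (d == 0) || (d == 3) -> d = o + j ->
  phi d0 d <= phi d0 o + (3 * j + 36 * ((d == 3) && (o == 0))).
Proof.
by case: d => [|[|[|[|d]]]] //; case: o => [|[|[|[|o]]]] //= _ dj; phi_lia.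
Qed.

(** Charge of a deleted vertex with [o] edges to survivors. The extreme case is degree 3: 45 + 2 *
    18 = 81 here, 45 + 18 = 63 in [phi_out2], and 45 + 2 * 42 = 129 in [phi_out_leaf]. *)
Lemma phi_out1 d0 d o : 2 <= d -> d <= 3 -> o + 1 <= d -> phi d0 d + 18 * o <= 81.
Proof. by case: d => [|[|[|[|d]]]] //= _ _ le; phi_lia. Qed.

Lemma phi_out2 d0 d o : 2 <= d -> d <= 3 -> o + 2 <= d -> phi d0 d + 18 * o <= 63.
Proof. by case: d => [|[|[|[|d]]]] //= _ _ le; phi_lia. Qed.

Lemma phi_le60 d0 d : phi d0 d <= 60.
Proof. by case: d => [|[|[|d]]] //=; case: ifP. Qed.

Lemma phi_out_leaf d0 d o : d <= 3 -> o + 1 <= d -> phi d0 d + 42 * o <= 129.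
Proof. by case: d => [|[|[|[|d]]]] //= _ le; phi_lia. Qed.

Lemma phi_deg d0 d : 2 <= d -> d <= 3 -> phi d0 d + 18 * d <= 99.
Proof. by case: d => [|[|[|[|d]]]] //= _ _; phi_lia. Qed.

Lemma lost_two d o j : d = o + j -> 2 * ((d == 2) && (o == 0)) <= j.
Proof. by case: (d =P 2) => ?; case: (o =P 0) => ? /=; lia. Qed.

Lemma lost_three d o j : d = o + j -> 3 * ((d == 3) && (o == 0)) <= j.
Proof. by case: (d =P 3) => ?; case: (o =P 0) => ? /=; lia. Qed.

Local Ltac adj :=
  first [ assumption | match goal with s : symmetric _ |- _ => rewrite s; assumption end
        | apply/orP; left; adj | apply/orP; right; adj ].

(** * Degrees in induced subgraphs and double counting *)

Section Greedy.
Variables (T : finType) (e : rel T).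
Hypotheses (e_sym : symmetric e) (e_irr : irreflexive e).
Implicit Types (S A B : {set T}) (u v w x y : T).

Definition nb S x : {set T} := [set y in S | e x y].
Definition dg S x : nat := #|nb S x|.
(** For an edge uv inside S each end is a neighbour of the other, so [gone] is the part of N[u] and
    N[v] in S although only open neighbourhoods are mentioned. *)
Definition rest S u v : {set T} := [set x in S | ~~ e u x && ~~ e v x].
Definition gone S u v : {set T} := [set x in S | e u x || e v x].

Lemma e_neq x y : e x y -> x != y.
Proof. by apply: contraTneq => ->; rewrite e_irr. Qed.

Lemma in_nb S x y : (y \in nb S x) = (y \in S) && e x y.
Proof. by rewrite inE. Qed.

Lemma dg_split S u v x : dg S x = dg (rest S u v) x + dg (gone S u v) x.
Proof.
rewrite /dg -(cardsID (rest S u v) (nb S x)).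
congr (_ + _); apply: eq_card => y; rewrite !inE.
  by case: (y \in S); rewrite //= andbC.
by case: (y \in S); case: (e u y); case: (e v y).
Qed.

(** Both sides count the adjacent pairs between [A] and [B]. With [rest] and [gone] this moves the
    losses of survivors to the deleted vertices. *)
Lemma sum_dg A B : \sum_(x in A) dg B x = \sum_(x in B) dg A x.
Proof.
have dgE C x : dg C x = \sum_(y in C) (e x y : nat).
  by rewrite /dg -sum1_card big_mkcond [RHS]big_mkcond /=;
    apply: eq_bigr => y _; rewrite inE; case: (y \in C); case: (e x y).
under eq_bigr do rewrite dgE; rewrite exchange_big /=.
by apply: eq_bigr => y _; rewrite dgE; apply: eq_bigr => x _; rewrite e_sym.
Qed.

(** The list may contain repetitions, so the cost estimates need no case distinction on coinciding
    neighbours. *)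
Lemma sum_le_seq A (s : seq T) (F : T -> nat) :
  {subset A <= s} -> \sum_(x in A) F x <= \sum_(x <- s) F x.
Proof.
elim: s A => [|y s IHs] A sA.
  by rewrite big_pred0 // => x; apply: contraFF _ (erefl false) => /sA.
rewrite big_cons; have [yA|nyA] := boolP (y \in A).
  rewrite (big_setD1 y) //= leq_add2l; apply: IHs => x.
  by rewrite !inE => /andP[/negbTE nx /sA]; rewrite inE nx.
apply: leq_trans (leq_addl _ _); apply: IHs => x xA.
have := sA _ xA; rewrite inE => /orP[/eqP xy|//].
by rewrite -xy xA in nyA.
Qed.

Lemma nbP S x n : dg S x = n ->
  exists s, [/\ size s = n, uniq s & nb S x =i s].
Proof.
move=> <-; exists (enum (nb S x)).
by rewrite -cardE enum_uniq; split=> // y; rewrite mem_enum.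
Qed.

Lemma nb_consP S x y n : dg S x = n.+1 -> y \in nb S x ->
  exists s, [/\ size s = n, uniq (y :: s) & nb S x =i y :: s].
Proof.
move=> dx yx; exists (enum (nb S x :\ y)).
rewrite -cardE; move: dx; rewrite /dg (cardsD1 y) yx => -[<-]; split=> //.
  by rewrite /= enum_uniq mem_enum !inE eqxx.
by move=> z; rewrite in_cons mem_enum in_setD1; case: eqP => // ->.
Qed.

Lemma nb2P S u v : dg S u = 2 -> v \in S -> e u v ->
  exists a, [/\ a \in S, e u a, v != a & nb S u =i [:: v; a]].
Proof.
move=> du vS uv; have vu : v \in nb S u by rewrite in_nb vS.
have [[|a [|b s]] [] //= _ /andP[va _] nbu] := nb_consP du vu.
have : a \in nb S u by rewrite nbu !inE eqxx orbT.
by rewrite in_nb => /andP[aS ua]; exists a; split=> //; rewrite inE in va.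
Qed.

Lemma nb3P S u v : dg S u = 3 -> v \in S -> e u v ->
  exists c d, [/\ c \in S, d \in S, e u c, e u d
    & uniq [:: v; c; d] /\ nb S u =i [:: v; c; d]].
Proof.
move=> du vS uv; have vu : v \in nb S u by rewrite in_nb vS.
have [[|c [|d [|b s]]] [] //= _ us nbu] := nb_consP du vu.
have : c \in nb S u by rewrite nbu !inE eqxx orbT.
have : d \in nb S u by rewrite nbu !inE eqxx !orbT.
by rewrite !in_nb => /andP[dS ud] /andP[cS uc]; exists c, d.
Qed.

Lemma nb3P2 S v u c : dg S v = 3 -> u \in S -> c \in S -> u != c ->
  e v u -> e v c -> exists d, [/\ d \in S, e v d, uniq [:: u; c; d]
                             & nb S v =i [:: u; c; d]].
Proof.
move=> dv uS cS uc vu vc.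
have [a [b [aS bS va vb [us nbv]]]] := nb3P dv uS vu.
have : c \in nb S v by rewrite in_nb cS.
move: us; rewrite nbv /= !inE negb_or [c == u]eq_sym (negbTE uc) /= andbT.
case/andP=> /andP[ua ub] ab /orP[] /eqP->.
  by exists b; split=> //; rewrite !inE negb_or ua ub ab.
exists a; split=> //; first by rewrite !inE negb_or ua ub eq_sym ab.
by move=> x; rewrite nbv !inE; do 3!case: (x == _).
Qed.

Lemma nb_eq S x s :
  uniq s -> {subset s <= nb S x} -> dg S x <= size s -> nb S x =i s.
Proof.
move=> us sx le y; have [||_ ->] := uniq_min_size us _ (s2 := enum (nb S x)).
- by move=> z /sx; rewrite mem_enum.
- by rewrite -cardE.
by rewrite mem_enum.
Qed.

Lemma dg_known S x s : uniq s -> {subset s <= nb S x} -> size s <= dg S x.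
Proof.
move=> us sx; rewrite /dg cardE; apply: uniq_leq_size => // z /sx.
by rewrite mem_enum.
Qed.

(** Every known neighbour of [x] in the deleted set is one edge fewer from [x] to the survivors. *)
Lemma rest_known S u v x s : uniq s ->
  (forall y, y \in s -> [&& y \in S, e x y & e u y || e v y]) ->
  dg (rest S u v) x + size s <= dg S x.
Proof.
move=> us sx; rewrite (dg_split S u v x) leq_add2l; apply: dg_known => // y.
by move/sx => /and3P[yS xy uvy]; rewrite !inE yS xy uvy.
Qed.

Lemma rest_known1 S u v x y : y \in S -> e x y -> e u y || e v y ->
  dg (rest S u v) x + 1 <= dg S x.
Proof.
move=> yS xy uvy; apply: (@rest_known S u v x [:: y]) => // z.
by rewrite inE => /eqP->; rewrite yS xy.
Qed.

Lemma rest_known2 S u v x y z : y != z -> y \in S -> z \in S ->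
  e x y -> e x z -> e u y || e v y -> e u z || e v z ->
  dg (rest S u v) x + 2 <= dg S x.
Proof.
move=> yz yS zS xy xz uvy uvz; apply: (@rest_known S u v x [:: y; z]).
  by rewrite /= inE yz.
by move=> t; rewrite !inE => /orP[] /eqP->; rewrite ?yS ?zS ?xy ?xz.
Qed.

Lemma rest0l S u v : dg (rest S u v) u = 0.
Proof. by apply: eq_card0 => y; rewrite !inE; case: (e u y); rewrite ?andbF. Qed.

Lemma rest0r S u v : dg (rest S u v) v = 0.
Proof. by apply: eq_card0 => y; rewrite !inE; case: (e v y); rewrite ?andbF. Qed.

Definition pot S0 S : nat := \sum_(x in S) phi (dg S0 x) (dg S x).

(** Deleted vertices forfeit their whole potential; [l] bounds the loss of each survivor. *)
Lemma pot_drop S0 S u v (l : T -> nat) :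
    (forall x, x \in rest S u v ->
      phi (dg S0 x) (dg S x) <= phi (dg S0 x) (dg (rest S u v) x) + l x) ->
  pot S0 S <= pot S0 (rest S u v)
    + (\sum_(x in gone S u v) phi (dg S0 x) (dg S x)
       + \sum_(x in rest S u v) l x).
Proof.
move=> le; rewrite {1}/pot (big_setID (gone S u v)) /=.
have -> : S :&: gone S u v = gone S u v.
  by apply/setP => x; rewrite !inE; case: (x \in S).
have -> : S :\: gone S u v = rest S u v.
  by apply/setP => x; rewrite !inE negb_and negb_or; case: (x \in S);
     rewrite ?andbF ?andbT.
by rewrite addnCA leq_add2l -big_split /=; apply: leq_sum.
Qed.

Definition good S0 S u v : Prop :=
  [/\ u \in S, v \in S, e u v & pot S0 S <= pot S0 (rest S u v) + 350].

Lemma goneP S u v x : x \in gone S u v -> x \in nb S u \/ x \in nb S v.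
Proof. by rewrite !inE => /andP[-> /orP[]->]; [left|right]. Qed.

(** * Cheap edges: the leaf case *)

Section Existence.
Variables (S0 S : {set T}).
Hypotheses (S_deg : forall x, x \in S -> dg S x <= 3).

(** Take the edge at the leaf. In the worst case [v] has degree 3: 42 + 45 for the two ends and 129
    for each of the other two neighbours of [v], in total 345. *)
Lemma leaf_good u : u \in S -> dg S u = 1 -> exists v, good S0 S u v.
Proof.
move=> uS du.
have [su [+ _ nbu]] := nbP du; case: su nbu => [|v []] // nbu _.
have : v \in nb S u by rewrite nbu inE.
rewrite inE => /andP[vS uv]; exists v; split=> //.
have vu : u \in nb S v by rewrite inE uS e_sym.
have [n dv] : exists n, dg S v = n.+1.
  by exists (dg S v).-1; rewrite prednK // /dg (cardsD1 u) vu.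
have [s [ss us nbv]] := nb_consP dv vu.
have ln : n <= 2 by rewrite -ltnS -dv S_deg.
apply: leq_trans (@pot_drop _ S u v (fun x => 42 * dg (gone S u v) x) _) _.
  move=> x; rewrite inE => /andP[/S_deg d3 _].
  exact: phi_loss_leaf d3 (dg_split S u v x).
rewrite leq_add2l -big_distrr /= sum_dg big_distrr -big_split /=.
apply: leq_trans (sum_le_seq (s := v :: u :: s) _ _) _.
  move=> x /goneP[]; rewrite ?nbu ?nbv !inE; first by move=> ->.
  by case/orP=> ->; rewrite ?orbT.
rewrite !big_cons rest0l rest0r !muln0 !addn0 du.
have bs x : x \in s -> phi (dg S0 x) (dg S x) + 42 * dg (rest S u v) x <= 129.
  move=> xs; have : x \in nb S v by rewrite nbv inE xs orbT.
  rewrite inE => /andP[xS vx].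
  have H : dg (rest S u v) x + 1 <= dg S x by apply: (rest_known1 vS); adj.
  exact: phi_out_leaf (S_deg xS) H.
have lv : phi (dg S0 v) (dg S v) + \sum_(x <- s) 129 <= 303.
  rewrite big_const_seq count_predT iter_addn addn0 ss dv.
  by case: n ln {dv ss} => [|[|[|n]]] // _; phi_lia.
have : \sum_(x <- s) (phi (dg S0 x) (dg S x) + 42 * dg (rest S u v) x)
  <= \sum_(x <- s) 129.
  by rewrite !big_seq; apply: leq_sum.
move: lv; set X := \sum_(x <- s) _; set Y := \sum_(x <- s) _.
by rewrite /phi -/(phi _ _); lia.
Qed.


Hypothesis S_sub : S \subset S0.

Hypothesis S0_c4 : forall u v a c, u \in S0 -> v \in S0 -> a \in S0 -> c \in S0 ->
  dg S0 u = 2 -> v != a -> c != u -> e u v -> e u a -> e v c -> e a c -> False.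

(** * Cheap edges: no leaves, some vertex of degree 2 *)

Section MinDegree2.
Hypothesis S_leaf : forall x, x \in S -> dg S x != 1.

Definition lost u v : nat :=
  \sum_(x in rest S u v) ((dg S x == 2) && (dg (rest S u v) x == 0)).

Lemma deg2_drop u v s : {subset gone S u v <= s} ->
  pot S0 S <= pot S0 (rest S u v)
    + (\sum_(x <- s) (phi (dg S0 x) (dg S x) + 18 * dg (rest S u v) x)
       + 24 * lost u v).
Proof.
move=> sR.
apply: leq_trans (@pot_drop _ S u v (fun x => 18 * dg (gone S u v) x
  + 24 * ((dg S x == 2) && (dg (rest S u v) x == 0))) _) _.
  move=> x; rewrite inE => /andP[xS _].
  exact: phi_loss_deg2 (S_deg xS) (S_leaf xS) (dg_split S u v x).
rewrite leq_add2l [X in _ + X <= _]big_split /= addnA -!big_distrr /=.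
by rewrite leq_add2r sum_dg big_distrr -big_split /= sum_le_seq.
Qed.

(** Each lost vertex absorbs two of the edges leaving the deleted set. *)
Lemma lost_le u v s : {subset gone S u v <= s} ->
  2 * lost u v <= \sum_(x <- s) dg (rest S u v) x.
Proof.
move=> sR; apply: leq_trans (sum_le_seq _ sR).
rewrite -sum_dg big_distrr /=; apply: leq_sum => x _.
exact: lost_two (dg_split S u v x).
Qed.

Lemma dg_ge2 x y : x \in S -> y \in S -> e x y -> 2 <= dg S x.
Proof.
move=> xS yS xy; have := S_leaf xS.
have : 0 < dg S x by rewrite card_gt0; apply/set0Pn; exists y; rewrite inE yS.
by case: (dg S x) => [|[]].
Qed.

(** At most four edges leave the deleted set, so at most two vertices are lost: 2 * 60 + 2 * 81 + 2
    * 24 = 330. *)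
Lemma adjacent_deg2_good u v : u \in S -> v \in S -> e u v ->
  dg S u = 2 -> dg S v = 2 -> exists u v, good S0 S u v.
Proof.
move=> uS vS uv du dv; exists u, v; split=> //.
have vu : e v u by rewrite e_sym.
have [a [aS ua _ nbu]] := nb2P du vS uv.
have [c [cS vc _ nbv]] := nb2P dv uS vu.
have sR : {subset gone S u v <= [:: u; v; a; c]}.
  by move=> x /goneP[]; rewrite ?nbu ?nbv !inE => /orP[]->; rewrite ?orbT.
apply: leq_trans (deg2_drop sR) _; rewrite leq_add2l.
have := lost_le sR; rewrite !big_cons !big_nil rest0l rest0r.
have oa : dg (rest S u v) a + 1 <= dg S a by apply: (rest_known1 uS); adj.
have oc : dg (rest S u v) c + 1 <= dg S c by apply: (rest_known1 vS); adj.
have da := dg_ge2 aS uS (etrans (e_sym _ _) ua).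
have dc := dg_ge2 cS vS (etrans (e_sym _ _) vc).
have := phi_out1 (dg S0 a) da (S_deg aS) oa.
have := phi_out1 (dg S0 c) dc (S_deg cS) oc.
have := phi_le60 (dg S0 u) (dg S u).
have := phi_le60 (dg S0 v) (dg S v).
by move: (S_deg aS) (S_deg cS) oa oc; clear; lia.
Qed.

Lemma deg2_or3 x y : x \in S -> y \in S -> e x y -> dg S x = 2 \/ dg S x = 3.
Proof.
move=> xS yS xy; have := dg_ge2 xS yS xy; have := S_deg xS.
by case: (dg S x) => [|[|[|[|d]]]] // _ _; [left | right].
Qed.

(** The 4-cycle shows that [u] did not have degree 2 in [S0], so its potential is 50 and not 60.
    Unless two adjacent vertices of degree 2 exist, [v] and [a] have degree 3. Again at most four
    edges leave: 50 + 45 + 63 + 63 + 81 + 2 * 24 = 350, without slack. *)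
Lemma c4_good u v a c : u \in S -> v \in S -> a \in S -> c \in S -> dg S u = 2 ->
  v != a -> c != u -> e u v -> e u a -> e v c -> e a c ->
  exists u v, good S0 S u v.
Proof.
move=> uS vS aS cS du va cu uv ua vc ac.
have vu : e v u by rewrite e_sym.
have [dv|dv] := deg2_or3 vS uS vu; first exact: (adjacent_deg2_good uS vS).
have au : e a u by rewrite e_sym.
have [da|da] := deg2_or3 aS uS au; first exact: (adjacent_deg2_good uS aS).
have nbu : nb S u =i [:: v; a].
  apply: nb_eq; rewrite ?du //= ?inE ?va // => x.
  by rewrite !inE => /orP[] /eqP->; apply/andP.
rewrite eq_sym in cu.
have [d [dS vd us nbv]] := nb3P2 dv uS cS cu vu vc.
have du0 : dg S0 u != 2.
  by apply/eqP => d0; apply: (S0_c4 (c := c) _ _ _ _ d0 va _ uv ua vc ac);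
    rewrite ?(subsetP S_sub) // eq_sym.
exists u, v; split=> //.
have sR : {subset gone S u v <= [:: u; v; a; c; d]}.
  by move=> x /goneP[]; rewrite ?nbu ?nbv !inE;
    do ?[case/orP]; move=> ->; rewrite ?orbT.
apply: leq_trans (deg2_drop sR) _; rewrite leq_add2l.
have := lost_le sR; rewrite !big_cons !big_nil rest0l rest0r.
have oa : dg (rest S u v) a + 2 <= dg S a by apply: (rest_known2 cu); adj.
have oc : dg (rest S u v) c + 2 <= dg S c by apply: (rest_known2 va); adj.
have od : dg (rest S u v) d + 1 <= dg S d by apply: (rest_known1 vS); adj.
have cv : e c v by rewrite e_sym.
have dv' : e d v by rewrite e_sym.
have dd := dg_ge2 dS vS dv'; have dc := dg_ge2 cS vS cv.
have := phi_out1 (dg S0 d) dd (S_deg dS) od.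
have := phi_out2 (dg S0 c) dc (S_deg cS) oc.
have := S_deg cS; have := S_deg dS; move: oa oc od.
by rewrite da dv du /= (negbTE du0); clear; lia.
Qed.

Section NoC4.
Hypothesis S_c4 : forall u v a c, u \in S -> v \in S -> a \in S -> c \in S ->
  dg S u = 2 -> v != a -> c != u -> e u v -> e u a -> e v c -> e a c -> False.

(** The 5-cycle is u, v, c, w, a. The edge wa is taken: [v] survives but has two edges into the
    deleted set, which cost it only 3 if its third edge remains. With [q] the third neighbour of
    [a], at most five edges leave {w, a, c, u, q}, and two or three of them end in [v]. *)
Lemma c5_good u v a c w : u \in S -> v \in S -> a \in S -> c \in S -> w \in S ->
  dg S u = 2 -> dg S w = 2 -> u != w -> a != c -> v != a -> ~~ e a v ->
  e u v -> e u a -> e w a -> e w c -> e v c ->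
  exists u v, good S0 S u v.
Proof.
move=> uS vS aS cS wS du dw uw ac va nav uv ua wa wc vc.
have au : e a u by rewrite e_sym.
have aw : e a w by rewrite e_sym.
have cw : e c w by rewrite e_sym.
have cv : e c v by rewrite e_sym.
have vu : e v u by rewrite e_sym.
have [da|da] := deg2_or3 aS uS au; first exact: (adjacent_deg2_good uS aS).
have [dc|dc] := deg2_or3 cS wS cw; first exact: (adjacent_deg2_good wS cS).
have [dv|dv] := deg2_or3 vS uS vu; first exact: (adjacent_deg2_good uS vS).
have nbw : nb S w =i [:: a; c].
  apply: nb_eq; rewrite ?dw //= ?inE ?ac // => x.
  by rewrite !inE => /orP[] /eqP->; apply/andP.
have nbu : nb S u =i [:: a; v].
  apply: nb_eq; rewrite ?du //= ?inE 1?eq_sym ?va // => x.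
  by rewrite !inE => /orP[] /eqP->; apply/andP.
have [q [qS aq usq nba]] := nb3P2 da wS uS (etrans (congr1 negb (eq_sym _ _)) uw) aw au.
have qa : e q a by rewrite e_sym.
have dq := dg_ge2 qS aS qa; have dq3 := S_deg qS.
exists w, a; split=> //.
set R := gone S w a; set S' := rest S w a.
have sR : {subset R <= [:: w; a; c; u; q]}.
  by move=> x /goneP[]; rewrite ?nbw ?nba !inE;
    do ?[case/orP]; move=> ->; rewrite ?orbT.
have ou : dg S' u + 1 <= dg S u by apply: (rest_known1 aS); adj.
have oc : dg S' c + 1 <= dg S c by apply: (rest_known1 wS); adj.
have oq : dg S' q + 1 <= dg S q by apply: (rest_known1 aS); adj.
have vc_neq := e_neq vc.
have vS' : v \in S'.
  rewrite inE vS nav andbT; apply/negP => wv.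
  have : v \in nb S w by rewrite inE vS.
  by rewrite nbw !inE (negbTE va) (negbTE vc_neq).
have uc : u != c by apply/eqP => E; move: du; rewrite E dc.
have uR : u \in R by rewrite inE uS au orbT.
have cR : c \in R by rewrite inE cS wc.
have jv2 : 2 <= dg R v.
  apply: (@dg_known R v [:: u; c]); first by rewrite /= inE uc.
  by move=> x; rewrite in_cons mem_seq1 in_nb => /orP[] /eqP->; rewrite ?uR ?cR.
have jv3 : dg R v <= 3 by rewrite -dv (dg_split S w a) leq_addl.
pose b x : nat := (dg S x == 2) && (dg S' x == 0).
(* The vertex [v] falls from degree 3 to 1 (loss 3) or to 0 (loss 45); the general rate of 18 per
   edge would overcharge it. *)
pose l x := if x == v then (if dg R v == 2 then 3 else 45)
            else 18 * dg R x + 24 * b x.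
apply: leq_trans (@pot_drop S0 S w a l _) _.
  move=> x; rewrite inE /l => /andP[xS _]; case: eqP => [->|_].
    move: (dg_split S w a v) jv2 jv3; rewrite -/R -/S' dv.
    case: (dg R v) => [|[|[|[|r]]]] //; case: (dg S' v) => [|[|o]] //=;
      by move=> + _ _; clear; phi_lia.
  exact: phi_loss_deg2 (S_deg xS) (S_leaf xS) (dg_split S w a x).
rewrite leq_add2l -/S' -/R [\sum_(x in S') _](big_setD1 v vS') /= {1}/l eqxx.
set D := S' :\ v.
have -> : \sum_(x in D) l x = 18 * \sum_(x in D) dg R x + 24 * \sum_(x in D) b x.
  rewrite !big_distrr -big_split /=; apply: eq_bigr => x.
  by rewrite /l in_setD1 => /andP[/negbTE->].
have lD : 2 * \sum_(x in D) b x <= \sum_(x in D) dg R x.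
  by rewrite big_distrr; apply: leq_sum => x _; apply: lost_two (dg_split S w a x).
have := sum_le_seq (fun x => phi (dg S0 x) (dg S x)) sR.
have : dg R v + \sum_(x in D) dg R x <= \sum_(x <- [:: w; a; c; u; q]) dg S' x.
  have <- : \sum_(x in S') dg R x = dg R v + \sum_(x in D) dg R x.
    by rewrite (big_setD1 v vS').
  by rewrite sum_dg; apply: sum_le_seq.
rewrite !big_cons !big_nil rest0l rest0r du dw da dc.
(* If [v] loses all its edges, its neighbours are [u], [c], [q]. Another lost vertex [x] could only
   have the neighbours [c] and [q], making x, c, v, q a 4-cycle through a vertex of degree 2. Its
   surcharge of 24 would exceed the budget. *)
have b0 : dg R v = 3 -> \sum_(x in D) b x = 0.
  move=> jv; apply: big1 => x; rewrite in_setD1 inE => /andP[xv /and3P[xS nwx nax]].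
  apply/eqP; rewrite eqb0; apply/negP => /andP[/eqP dx /eqP ox].
  have sub y : y \in S -> e x y -> y = c \/ y = q.
    move=> yS xy; have : y \in R.
      rewrite inE yS; apply: contraPT ox => nR; apply/eqP; rewrite -lt0n card_gt0.
      by apply/set0Pn; exists y; rewrite !inE yS xy -negb_or nR.
    move=> /sR; rewrite !inE => /or4P[/eqP E|/eqP E|/eqP E|/orP[]/eqP E]; subst y.
    - by rewrite e_sym xy in nwx.
    - by rewrite e_sym xy in nax.
    - by left.
    - have : x \in nb S u by rewrite inE xS e_sym.
      rewrite nbu !inE (negbTE xv) orbF => /eqP xa; subst x.
      by rewrite wa in nwx.
    by right.
  have [y [z [yS xy]]] : exists y z, [/\ y \in S, e x y, z \in S /\ e x z & y != z].
    have [s [ss us nbx]] := nbP dx; case: s ss us nbx => [|y [|z []]] //= _ us nbx.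
    have : y \in nb S x by rewrite nbx !inE eqxx.
    have : z \in nb S x by rewrite nbx !inE eqxx orbT.
    rewrite !in_nb => /andP[zS xz] /andP[yS xy]; exists y, z; split=> //.
    by move: us; rewrite inE andbT.
  move=> [zS xz] yz.
  have vq : e v q.
    apply: contraTT isT => nvq; suff : dg R v <= 2 by rewrite jv.
    rewrite -[2]/(size [:: u; c]) /dg cardE; apply: uniq_leq_size => [|t].
      exact: enum_uniq.
    rewrite mem_enum in_nb => /andP[/sR + vt].
    rewrite !inE => /or4P[/eqP E|/eqP E|->|/orP[->|/eqP E]]; rewrite ?orbT //; subst t.
    - have : v \in nb S w by rewrite inE vS e_sym.
      by rewrite nbw !inE (negbTE va) (negbTE vc_neq).
    - by rewrite e_sym vt in nav.
    by rewrite vt in nvq.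
  have [E|E] := sub y yS xy; have [F|F] := sub z zS xz; subst y z; rewrite ?eqxx // in yz.
  - by apply: (S_c4 xS cS qS vS dx yz _ xy xz); rewrite 1?eq_sym // e_sym.
  by apply: (S_c4 xS qS cS vS dx yz _ xy xz); rewrite 1?eq_sym // e_sym.
have phi3 d0 : phi d0 3 = 45 by [].
have := phi_le60 (dg S0 w) 2; have := phi_le60 (dg S0 u) 2.
move: ou oc oq; rewrite du dc.
have [jv|jv] : dg R v = 2 \/ dg R v = 3.
  by move: jv2 jv3; case: (dg R v) => [|[|[|[|r]]]] //; [left|right].
  rewrite jv /= in lD *.
  move: lD dq3 (phi_deg (dg S0 q) dq dq3); rewrite ?phi3; clear; lia.
rewrite b0 // jv /=.
by move: (phi_deg (dg S0 q) dq dq3); rewrite ?phi3; clear; lia.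
Qed.

(** If [v] has degree 3 and no vertex is lost, uv costs at most 60 + 45 + 3 * 81 = 348. A lost
    vertex [w] has its two neighbours among [a] and the neighbours of [v]. If both are adjacent to
    [v], there is a 4-cycle through [w]; otherwise one is [a], the other is adjacent to [v], and
    [c5_good] applies. *)
Lemma deg2_noC4_good u : u \in S -> dg S u = 2 -> exists u v, good S0 S u v.
Proof.
move=> uS du; have [s [ss us nbu]] := nbP du.
case: s ss us nbu => [|v [|a []]] //= _; rewrite inE andbT => va nbu.
have : v \in nb S u by rewrite nbu !inE eqxx.
have : a \in nb S u by rewrite nbu !inE eqxx orbT.
rewrite !in_nb => /andP[aS ua] /andP[vS uv].
have au : e a u by rewrite e_sym.
have vu : e v u by rewrite e_sym.
have [dv|dv] := deg2_or3 vS uS vu; first exact: (adjacent_deg2_good uS vS).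
have [c [d [cS dS vc vd [_ nbv]]]] := nb3P dv uS vu.
have sR : {subset gone S u v <= [:: u; v; a; c; d]}.
  by move=> x /goneP[]; rewrite ?nbu ?nbv !inE;
    do ?[case/orP]; move=> ->; rewrite ?orbT.
have [l0|] := posnP (lost u v); last first.
  rewrite lt0n sum_nat_eq0 negb_forall => /existsP[w]; rewrite negb_imply eqb0 negbK.
  case/and3P; rewrite inE => /and3P[wS nuw nvw] /eqP dw /eqP ow.
  have [s [ss us nbw]] := nbP dw.
  case: s ss us nbw => [|y [|z []]] //= _; rewrite inE andbT => yz nbw.
  have : y \in nb S w by rewrite nbw !inE eqxx.
  have : z \in nb S w by rewrite nbw !inE eqxx orbT.
  rewrite !in_nb => /andP[zS wz] /andP[yS wy].
  have nwu t : e w t -> t != u by apply: contraTneq => ->; rewrite e_sym.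
  have nwv t : e w t -> t != v by apply: contraTneq => ->; rewrite e_sym.
  have nbrs t : t \in S -> e w t -> t = a \/ e v t.
    move=> tS wt; have : t \in gone S u v.
      rewrite inE tS; apply: contraPT ow => nR; apply/eqP; rewrite -lt0n card_gt0.
      by apply/set0Pn; exists t; rewrite !inE tS wt -negb_or nR.
    case/goneP; last by rewrite inE => /andP[_]; right.
    by rewrite nbu !inE (negbTE (nwv _ wt)) => /eqP; left.
  have vw : v != w by apply: contraNneq nuw => <-.
  have uw : u != w by apply: contraNneq nvw => <-.
  have [avt|nav] := boolP (e a v).
    have nbrs' t : t \in S -> e w t -> e t v.
      by move=> tS /(nbrs _ tS)[-> // | vt]; rewrite e_sym.
    by case: (S_c4 wS yS zS vS dw yz vw wy wz (nbrs' _ yS wy) (nbrs' _ zS wz)).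
  have [ya|vy] := nbrs _ yS wy; have [za|vz] := nbrs _ zS wz.
  - by rewrite ya za eqxx in yz.
  - by subst y; apply: (c5_good uS vS aS zS wS).
  - by subst z; apply: (c5_good uS vS aS yS wS) => //; rewrite eq_sym.
  by case: (S_c4 wS yS zS vS dw yz vw wy wz); rewrite e_sym.
exists u, v; split=> //.
apply: leq_trans (deg2_drop sR) _; rewrite leq_add2l l0.
rewrite !big_cons !big_nil rest0l rest0r du dv.
have oa : dg (rest S u v) a + 1 <= dg S a by apply: (rest_known1 uS); adj.
have oc : dg (rest S u v) c + 1 <= dg S c by apply: (rest_known1 vS); adj.
have od : dg (rest S u v) d + 1 <= dg S d by apply: (rest_known1 vS); adj.
have cv : e c v by rewrite e_sym.
have dv' : e d v by rewrite e_sym.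
have da := dg_ge2 aS uS au; have dc := dg_ge2 cS vS cv; have dd := dg_ge2 dS vS dv'.
move: (phi_out1 (dg S0 a) da (S_deg aS) oa) (phi_out1 (dg S0 c) dc (S_deg cS) oc)
  (phi_out1 (dg S0 d) dd (S_deg dS) od) (phi_le60 (dg S0 u) 2).
have -> : phi (dg S0 v) 3 = 45 by [].
by clear; lia.
Qed.

End NoC4.

Lemma deg2_good u : u \in S -> dg S u = 2 -> exists u v, good S0 S u v.
Proof.
pose c4 u v a c := [&& u \in S, v \in S, a \in S, c \in S & dg S u == 2]
  && [&& v != a, c != u, e u v, e u a, e v c & e a c].
have [/existsP[u' /existsP[v /existsP[a /existsP[c]]]]|no] :=
    boolP [exists u, exists v, exists a, exists c, c4 u v a c].
  case/andP=> /and5P[uS vS aS cS /eqP du] /and5P[va cu uv ua /andP[vc ac]] _ _.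
  exact: (c4_good uS vS aS cS).
apply: deg2_noC4_good => u' v a c uS vS aS cS du va cu uv ua vc ac.
move/negP: no; apply; apply/existsP; exists u'; apply/existsP; exists v.
apply/existsP; exists a; apply/existsP; exists c.
by rewrite /c4 uS vS aS cS du va cu uv ua vc ac.
Qed.

End MinDegree2.

(** * Cheap edges: all degrees 0 or 3 *)

Section Cubic.
Hypothesis S_cubic : forall x, x \in S -> (dg S x == 0) || (dg S x == 3).

Lemma cubic_dg x y : x \in S -> y \in S -> e x y -> dg S x = 3.
Proof.
move=> xS yS xy; have : 0 < dg S x.
  by rewrite card_gt0; apply/set0Pn; exists y; rewrite inE yS.
by case/orP: (S_cubic xS) => /eqP->.
Qed.

Definition isolated u v : {set T} :=
  [set x in rest S u v | (dg S x == 3) && (dg (rest S u v) x == 0)].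

Lemma card_isolated u v : #|isolated u v| =
  \sum_(x in rest S u v) ((dg S x == 3) && (dg (rest S u v) x == 0)).
Proof.
rewrite -sum1_card big_mkcond [RHS]big_mkcond /=; apply: eq_bigr => x _.
by rewrite !inE; case: (x \in S); case: (e u x); case: (e v x);
  case: (dg S x == 3); case: (dg _ x == 0).
Qed.

Lemma cubic_drop u v s : {subset gone S u v <= s} ->
  pot S0 S <= pot S0 (rest S u v)
    + (45 * #|gone S u v| + (3 * \sum_(x <- s) dg (rest S u v) x
       + 36 * #|isolated u v|)).
Proof.
move=> sR.
apply: leq_trans (@pot_drop _ S u v (fun x => 3 * dg (gone S u v) x
  + 36 * ((dg S x == 3) && (dg (rest S u v) x == 0))) _) _.
  move=> x; rewrite inE => /andP[xS _].
  exact: phi_loss_cubic (S_cubic xS) (dg_split S u v x).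
rewrite leq_add2l big_split /= -!big_distrr /= -card_isolated sum_dg.
rewrite leq_add ?leq_add ?leq_mul ?sum_le_seq //.
rewrite mulnC -sum_nat_const; apply: leq_sum => x; rewrite inE => /andP[xS _].
by case/orP: (S_cubic xS) => /eqP->.
Qed.

Lemma isolated_le u v s : {subset gone S u v <= s} ->
  3 * #|isolated u v| <= \sum_(x <- s) dg (rest S u v) x.
Proof.
move=> sR; apply: leq_trans (sum_le_seq _ sR).
rewrite -sum_dg card_isolated big_distrr /=; apply: leq_sum => x _.
exact: lost_three (dg_split S u v x).
Qed.

Lemma card_gone_le u v s : {subset gone S u v <= s} -> #|gone S u v| <= size s.
Proof.
move=> sR; apply: leq_trans (card_size s); apply: subset_leq_card.
by apply/subsetP => x /sR.
Qed.

(** At most 2 + 1 + 1 + 1 = 5 edges leave the deleted set {w, c, b, d, h, w'}, so at most one vertex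
    gets isolated: 6 * 45 + 5 * 3 + 36 = 321. *)
Lemma shared_neighbours_good h b c d w w' : h \in S -> b \in S -> c \in S ->
  d \in S -> w \in S -> w' \in S -> uniq [:: b; c; d] -> uniq [:: h; w; w'] ->
  e h c -> e h d -> e w b -> e w c -> e w d -> e w' c -> e w' b || e w' d ->
  good S0 S w c.
Proof.
move=> hS bS cS dS wS w'S ubcd uhw hc hd wb wc wd w'c w'bd; split=> //.
have nbw : nb S w =i [:: b; c; d].
  apply: nb_eq; rewrite ?(cubic_dg wS bS wb) // => x.
  by rewrite in_nb !inE => /or3P[] /eqP->; apply/andP.
have ch : e c h by rewrite e_sym.
have cw : e c w by rewrite e_sym.
have cw' : e c w' by rewrite e_sym.
have bw : e b w by rewrite e_sym.
have dw : e d w by rewrite e_sym.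
have dh : e d h by rewrite e_sym.
have nbc : nb S c =i [:: h; w; w'].
  apply: nb_eq; rewrite ?(cubic_dg cS hS ch) // => x.
  by rewrite in_nb !inE => /or3P[] /eqP->; apply/andP.
have sR : {subset gone S w c <= [:: w; c; b; d; h; w']}.
  by move=> x /goneP[]; rewrite ?nbw ?nbc !inE;
    do ?[case/orP]; move=> ->; rewrite ?orbT.
move: ubcd uhw; rewrite /= !inE !negb_or !andbT => /andP[/andP[bc bd] cd].
case/andP=> /andP[hw hw'] ww'.
have ob : dg (rest S w c) b + 1 <= dg S b by apply: (rest_known1 wS); adj.
have od : dg (rest S w c) d + 2 <= dg S d by apply: (rest_known2 hw); adj.
have oh : dg (rest S w c) h + 2 <= dg S h by apply: (rest_known2 cd); adj.
have ow' : dg (rest S w c) w' + 2 <= dg S w'.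
  case/orP: w'bd => w'x; first by apply: (rest_known2 bc); adj.
  by apply: (rest_known2 cd); adj.
apply: leq_trans (cubic_drop sR) _; rewrite leq_add2l.
move: (card_gone_le sR) (isolated_le sR) ob od oh ow'.
rewrite (cubic_dg bS wS bw) (cubic_dg dS wS dw) (cubic_dg hS cS hc).
rewrite (cubic_dg w'S cS w'c) !big_cons big_nil rest0l rest0r.
by clear; rewrite /=; lia.
Qed.

Local Ltac decide_adj := rewrite /= ?inE ?negb_or; repeat match goal with
  | H : is_true ?x |- context [?x] => rewrite H
  | H : e _ _ = _ |- _ => rewrite H
  end.

(* If uv is too costly, two remaining vertices w, w' have all their neighbours*)
(* among those of u and v; then some edge at w is cheap.                      *)
Lemma cubic_good u v : u \in S -> v \in S -> e u v -> exists u v, good S0 S u v.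
Proof.
move=> uS vS uv; have vu : e v u by rewrite e_sym.
have [a [b [aS bS ua ub [_ nbu]]]] := nb3P (cubic_dg uS vS uv) vS uv.
have [c [d [cS dS vc vd [_ nbv]]]] := nb3P (cubic_dg vS uS vu) uS vu.
have au : e a u by rewrite e_sym.
have bu : e b u by rewrite e_sym.
have cv : e c v by rewrite e_sym.
have dv : e d v by rewrite e_sym.
set s := [:: u; v; a; b; c; d].
have sR : {subset gone S u v <= s}.
  by move=> x /goneP[]; rewrite ?nbu ?nbv !inE;
    do ?[case/orP]; move=> ->; rewrite ?orbT.
have oa : dg (rest S u v) a + 1 <= dg S a by apply: (rest_known1 uS); adj.
have ob : dg (rest S u v) b + 1 <= dg S b by apply: (rest_known1 uS); adj.
have oc : dg (rest S u v) c + 1 <= dg S c by apply: (rest_known1 vS); adj.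
have od : dg (rest S u v) d + 1 <= dg S d by apply: (rest_known1 vS); adj.
have := cubic_drop sR; have := isolated_le sR; have := card_gone_le sR.
move: oa ob oc od.
rewrite (cubic_dg aS uS au) (cubic_dg bS uS bu) (cubic_dg cS vS cv).
rewrite (cubic_dg dS vS dv) !big_cons big_nil rest0l rest0r => oa ob oc od R6 il le.
(* At most eight edges leave, so at most two vertices get isolated. The cost is at most 5 * 45 + 24
   + 2 * 36 = 321 or 6 * 45 + 24 + 36 = 330; six deleted and two isolated vertices would give
   366. *)
have [small|] := boolP ((#|gone S u v| <= 5) || (#|isolated u v| <= 1)).
  exists u, v; split=> //; apply: leq_trans le _; rewrite leq_add2l.
  by move: oa ob oc od R6 il small; clear; rewrite /=; lia.
rewrite negb_or -!ltnNge => /andP[R5 i1].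
have us : uniq s.
  apply: (leq_size_uniq (enum_uniq (gone S u v))) => [x|]; last by rewrite -cardE.
  by rewrite mem_enum => /sR.
case/card_gt1P: i1 => w [w' [iw iw' ww']] {le il R5 R6 oa ob oc od}.
have iso x : x \in isolated u v ->
    [/\ x \in S, x != u, x != v & 3 <= e x a + (e x b + (e x c + (e x d + 0)))].
  rewrite !inE => /andP[/and3P[xS nux nvx] /andP[/eqP dx /eqP ox]].
  split=> //; [by apply: contraNneq nvx => -> | by apply: contraNneq nux => -> |].
  rewrite -dx /dg -sum1_card.
  apply: leq_trans (sum_le_seq (s := [seq y <- [:: a; b; c; d] | e x y]) _ _) _;
    last by rewrite sum1_size size_filter.
  move=> y.
  rewrite in_nb mem_filter => /andP[yS xy]; rewrite xy /=.
  have yR : y \in gone S u v.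
    rewrite inE yS; apply: contraPT ox => nR; apply/eqP; rewrite -lt0n card_gt0.
    by apply/set0Pn; exists y; rewrite !inE yS xy -negb_or nR.
  have := sR _ yR; rewrite inE => /orP[/eqP yu|].
    by rewrite e_sym -yu xy in nux.
  by rewrite inE => /orP[/eqP yv|//]; rewrite e_sym -yv xy in nvx.
have [wS wu wv w3] := iso _ iw; have [w'S w'u w'v w'3] := iso _ iw'.
move: us; rewrite /s /= !inE !negb_or !andbT.
case/and5P=> _ _ /and3P[ab ac ad] /andP[bc bd] cd.
have [ba ca da] : [/\ b != a, c != a & d != a] by rewrite ![_ == a]eq_sym.
have [cb db dc] : [/\ c != b, d != b & d != c] by rewrite ![_ == b]eq_sym [d == c]eq_sym.
have [uw uw' vw vw'] : [/\ u != w, u != w', v != w & v != w'].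
  by rewrite ![u == _]eq_sym ![v == _]eq_sym.
(* Each of [w], [w'] misses at most one of a, b, c, d. So [w] sees both outer neighbours of one end
   [h] of uv and one of the other end, and [w'] shares with [w] one of the former two and some
   further neighbour. *)
case wa: (e w a) w3; case wb: (e w b); case wc: (e w c); case wd: (e w d) => // _;
case w'a: (e w' a) w'3; case w'b: (e w' b); case w'c: (e w' c); case w'd: (e w' d) => // _;
  first
  [ by exists w, c; apply: (@shared_neighbours_good v b c d w w'); decide_adj
  | by exists w, d; apply: (@shared_neighbours_good v b d c w w'); decide_adj
  | by exists w, c; apply: (@shared_neighbours_good v a c d w w'); decide_adj
  | by exists w, d; apply: (@shared_neighbours_good v a d c w w'); decide_adj
  | by exists w, a; apply: (@shared_neighbours_good u c a b w w'); decide_adj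
  | by exists w, b; apply: (@shared_neighbours_good u c b a w w'); decide_adj
  | by exists w, a; apply: (@shared_neighbours_good u d a b w w'); decide_adj
  | by exists w, b; apply: (@shared_neighbours_good u d b a w w'); decide_adj ].
Qed.

End Cubic.

Lemma good_exists x y : x \in S -> y \in S -> e x y -> exists u v, good S0 S u v.
Proof.
move=> xS yS xy.
have [/exists_inP[u uS /eqP du]|leaf] := boolP [exists u in S, dg S u == 1].
  by have [v] := leaf_good uS du; exists u, v.
have S_leaf z : z \in S -> dg S z != 1.
  by move=> zS; move: leaf; rewrite negb_exists_in => /forall_inP/(_ z zS).
have [/exists_inP[u uS /eqP du]|deg2] := boolP [exists u in S, dg S u == 2].
  exact: (deg2_good S_leaf uS du).
apply: (cubic_good _ xS yS xy) => z zS.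
have := S_leaf z zS; have := S_deg zS.
move: deg2; rewrite negb_exists_in => /forall_inP/(_ z zS).
by case: (dg S z) => [|[|[|[|d]]]].
Qed.
End Existence.
End Greedy.

(** * Reductions, matchings and dual solutions *)

Section Solution.
Variable G : sgraph.
Implicit Types (S : {set vertex G}) (M Y : {set {set vertex G}}).
Implicit Types (u v x y : vertex G) (f g : {set vertex G}).

Local Notation e := (@adj G).
Local Notation e_sym := (@adj_sym G).
Local Notation e_irr := (@adj_irrefl G).

(** The edge uv is to enter the matching, pq and rs are to get weight 1. Having [p] and [r] among
    the deleted vertices keeps both edges out of the remaining graph. *)
Definition reducible S u v p q r s : bool :=
  [&& [&& u \in S, v \in S & e u v],
      [&& p \in S, q \in S, e p q & e u p || e v p],
      [&& r \in S, s \in S, e r s & e u r || e v r]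
    & [forall x, forall y, [&& x \in S, y \in S, e x y & e u x || e v x] ==>
        (x \in [:: p; q; r; s]) || (y \in [:: p; q; r; s])]].

(** The weighted edges are vq and vs, where [q] and [s] are the other neighbours of [v]: deleted
    edges at the leaf end in [v], all others meet [v], [q] or [s]. For smaller degree of [v], [q]
    and [s] coincide, possibly with [u]. *)
Lemma leaf_reducible S u : (forall x, x \in S -> dg e S x <= 3) ->
  u \in S -> dg e S u = 1 -> exists v p q r s, reducible S u v p q r s.
Proof.
move=> S_deg uS du.
have [[|v [|w t]] [] //= _ _ nbu] := nbP du.
have : v \in nb e S u by rewrite nbu inE.
rewrite in_nb => /andP[vS uv]; have vu : e v u by rewrite e_sym.
have [q [s [qS sS vq vs nbv]]] : exists q s, [/\ q \in S, s \in S, e v q, e v s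
    & forall x, x \in S -> e v x -> x \in [:: u; q; s]].
  have : 0 < dg e S v by rewrite card_gt0; apply/set0Pn; exists u; rewrite inE uS.
  have := S_deg v vS; case dv: (dg e S v) => [|[|[|[|d]]]] // _ _.
  - have [[|x [|w t]] [] //= _ _ nbv] := nbP dv.
    have : u \in nb e S v by rewrite inE uS.
    rewrite nbv inE => /eqP ux; exists u, u; split=> // z zS vz.
    have : z \in nb e S v by rewrite inE zS.
    by rewrite nbv -ux !inE => ->.
  - have [q [qS vq _ nbv]] := nb2P dv uS vu; exists q, q; split=> // z zS vz.
    have : z \in nb e S v by rewrite inE zS.
    by rewrite nbv !inE => /orP[]->; rewrite ?orbT.
  have [q [s [qS sS vq vs [_ nbv]]]] := nb3P dv uS vu.
  exists q, s; split=> // z zS vz; have : z \in nb e S v by rewrite inE zS.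
  by rewrite nbv.
exists v, v, q, v, s; apply/and4P; split; try by apply/and4P; rewrite uv.
  by apply/and3P.
apply/forallP => x; apply/forallP => y; apply/implyP => /and4P[xS yS xy].
have nbu' z : z \in S -> e u z -> z = v.
  by move=> zS uz; apply/eqP; have := nbu z; rewrite !inE zS uz.
case/orP=> [ux|vx]; first by rewrite (nbu' x xS ux) inE eqxx.
have := nbv x xS vx; rewrite !inE => /or3P[] /eqP E.
- by rewrite E in xy; rewrite (nbu' y yS xy) eqxx ?orbT.
- by rewrite E eqxx ?orbT.
by rewrite E eqxx ?orbT.
Qed.

(** The weighted edges are vd and ac, where [d] is the third neighbour of [v] (or [u] if there is
    none). Every deleted vertex except [u] is covered, and the edges at [u] end in [v] or [a]. *)
Lemma c4_reducible S u v a c : (forall x, x \in S -> dg e S x <= 3) ->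
  u \in S -> v \in S -> a \in S -> c \in S ->
  dg e S u = 2 -> v != a -> c != u -> e u v -> e u a -> e v c -> e a c ->
  exists p q r s, reducible S u v p q r s.
Proof.
move=> S_deg uS vS aS cS du va cu uv ua vc ac.
have vu : e v u by rewrite e_sym.
have nbu x : x \in S -> e u x -> (x == v) || (x == a).
  have : nb e S u =i [:: v; a].
    apply: nb_eq; rewrite ?du //= ?inE ?va // => y.
    by rewrite !inE => /orP[] /eqP->; apply/andP.
  by move=> H xS ux; have := H x; rewrite !inE xS ux => <-.
have [d [dS vd nbv]] : exists d, [/\ d \in S, e v d
    & forall x, x \in S -> e v x -> x \in [:: u; c; d]].
  have : 2 <= dg e S v.
    apply: (@dg_known _ e S v [:: u; c]); first by rewrite /= inE eq_sym cu.
    by move=> x; rewrite !inE => /orP[] /eqP->; apply/andP.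
  have := S_deg v vS; case dv: (dg e S v) => [|[|[|[|d]]]] // _ _.
  - have [x [xS vx _ nbv]] := nb2P dv uS vu; exists u; split=> // z zS vz.
    have : z \in nb e S v by rewrite inE zS.
    have : c \in nb e S v by rewrite inE cS.
    rewrite !nbv !inE (negbTE cu) => /eqP-> /orP[]->; rewrite ?orbT //.
  have cu' : u != c by rewrite eq_sym.
  have [d [dS vd _ nbv]] := nb3P2 dv uS cS cu' vu vc.
  exists d; split=> // z zS vz; have : z \in nb e S v by rewrite inE zS.
  by rewrite nbv.
exists v, d, a, c; apply/and4P; split; try by apply/and4P; rewrite ?uv ?ua.
  by apply/and3P.
apply/forallP => x; apply/forallP => y; apply/implyP => /and4P[xS yS xy].
rewrite !inE; case/orP=> [ux|vx].
  by case/orP: (nbu x xS ux) => ->; rewrite ?orbT.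
have := nbv x xS vx; rewrite !inE => /or3P[] /eqP E; rewrite ?E ?eqxx ?orbT //.
by rewrite E in xy; case/orP: (nbu y yS xy) => ->; rewrite ?orbT.
Qed.

(** * Invariants of the matching and of the weight-1 edges under deletion *)

Lemma edgesP f : reflect (exists u v, e u v /\ f = [set u; v]) (f \in edges G).
Proof.
rewrite inE; apply: (iffP existsP) => [[u /existsP[v /andP[uv /eqP->]]]|].
  by exists u, v.
by move=> [u [v [uv ->]]]; exists u; apply/existsP; exists v; rewrite uv eqxx.
Qed.

Lemma in_edges u v : ([set u; v] \in edges G) = e u v.
Proof.
apply/edgesP/idP => [[x [y [xy E]]]|uv]; last by exists u, v.
have nxy := e_neq e_irr xy.
have : x \in [set u; v] by rewrite E !inE eqxx.
have : y \in [set u; v] by rewrite E !inE eqxx orbT.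
rewrite !inE => /orP[] /eqP yE /orP[] /eqP xE; subst x y;
  rewrite ?eqxx // in nxy.
by rewrite e_sym.
Qed.

(** The second clause makes any edge inside [S] compatible with [M]. *)
Definition separated S M : Prop :=
  induced_matching M /\
  forall f x, f \in M -> x \in f -> x \notin S /\ forall y, y \in S -> ~~ e x y.

Lemma separated0 : separated setT set0.
Proof.
split; last by move=> f x; rewrite inE.
by split=> [|f g]; rewrite ?sub0set ?inE.
Qed.

Lemma separated_step S M u v : separated S M -> u \in S -> v \in S -> e u v ->
  separated (rest e S u v) ([set u; v] |: M) /\ [set u; v] \notin M.
Proof.
move=> [[Me Mind] Msep] uS vS uv.
have uvM : [set u; v] \notin M.
  by apply/negP => /(Msep _ u)[]; rewrite ?uS // !inE eqxx.
have old f x : f \in M -> x \in [set u; v] ->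
    x \notin f /\ forall y, y \in f -> ~~ e x y.
  move=> fM; rewrite !inE => xuv; have xS : x \in S by case/orP: xuv => /eqP->.
  split=> [|y yf]; first by apply/negP => /(Msep _ _ fM)[]; rewrite xS.
  by rewrite e_sym; have [_ ->] := Msep _ _ fM yf.
split=> //; split; last first.
  move=> f x /setU1P[->|fM] xf.
    split.
      have vu : e v u by rewrite e_sym.
      by move: xf; rewrite !inE => /orP[] /eqP->; rewrite ?uv ?vu ?andbF.
    by move: xf; rewrite !inE => /orP[] /eqP-> y; rewrite inE => /and3P[].
  have [xS sep] := Msep _ _ fM xf.
  by split=> [|y]; rewrite inE; [rewrite negb_and xS | case/andP=> /sep].
split.
  by apply/subsetP => f /setU1P[->|/(subsetP Me)//]; rewrite in_edges.
move=> f g /setU1P[->|fM] /setU1P[->|gM] fg.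
- by rewrite eqxx in fg.
- split; last by move=> x y xf /(old _ _ gM xf).2.
  by rewrite disjoint_subset; apply/subsetP => x /(old _ _ gM)[].
- split; last by move=> x y xf yg; rewrite e_sym; apply: (old _ _ fM yg).2.
  by rewrite disjoint_sym disjoint_subset; apply/subsetP => x /(old _ _ fM)[].
exact: Mind.
Qed.

(** Weight 1 on [Y] settles the constraints of all edges not inside [S]. As no edge of [Y] lies
    inside [S], the weights there can still be chosen freely. *)
Definition touching S Y : Prop :=
  [/\ Y \subset edges G, forall f, f \in Y -> ~~ (f \subset S)
    & forall f, f \in edges G -> ~~ (f \subset S) ->
        exists2 g, g \in Y & ~~ [disjoint f & g]].

Lemma touching0 : touching setT set0.
Proof. by split=> [|f|f _]; rewrite ?sub0set ?inE // subsetT. Qed.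

Lemma touching_step S Y u v p q r s :
  reducible S u v p q r s -> touching S Y ->
  touching (rest e S u v) ([set p; q] |: ([set r; s] |: Y)).
Proof.
case/and4P=> /and3P[uS vS uv] /and4P[pS qS pq up] /and4P[rS sS rs ur] /forallP cov.
case=> Ye YS Yt.
have outside x y : e u x || e v x -> ~~ ([set x; y] \subset rest e S u v).
  move=> ux; rewrite subUset sub1set !inE negb_and.
  by case/orP: ux => ->; rewrite ?andbF.
split.
- by apply/subsetP => f /setU1P[->|/setU1P[->|/(subsetP Ye)//]]; rewrite in_edges.
- move=> f /setU1P[->|/setU1P[->|fY]]; rewrite ?outside //.
  apply: contra (YS _ fY) => /subsetP sf; apply/subsetP => x /sf.
  by rewrite inE => /andP[].
move=> f fe; have [fS fR|fS _] := boolP (f \subset S); last first.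
  have [g gY fg] := Yt _ fe fS; exists g => //.
  by rewrite !inE gY !orbT.
have [x [y [xS yS xy [ux fE]]]] : exists x y, [/\ x \in S, y \in S, e x y
    & (e u x || e v x) /\ f = [set x; y]].
  have [x [y [xy fE]]] := edgesP _ fe.
  move: fS fR; rewrite fE !subUset !sub1set => /andP[xS yS].
  rewrite !inE xS yS /= !negb_and !negbK => /orP[] H.
    by exists x, y.
  by exists y, x; rewrite e_sym setUC.
have := cov x => /forallP/(_ y); rewrite xS yS xy ux /= fE.
have hit z g : z \in [set x; y] -> z \in g -> ~~ [disjoint [set x; y] & g].
  by move=> zxy zg; apply/pred0Pn; exists z; apply/andP.
have xin : x \in [set x; y] by rewrite !inE eqxx.
have yin : y \in [set x; y] by rewrite !inE eqxx orbT.
have pqY : [set p; q] \in [set p; q] |: ([set r; s] |: Y) by rewrite !inE eqxx.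
have rsY : [set r; s] \in [set p; q] |: ([set r; s] |: Y).
  by rewrite !inE eqxx orbT.
move=> xyp; have [z zxy] : exists2 z, z \in [set x; y] & z \in [:: p; q; r; s].
  by case/orP: xyp; [exists x | exists y].
rewrite !inE orbA => /orP[zpq|zrs].
  by exists [set p; q] => //; apply: (hit z); rewrite // !inE.
by exists [set r; s] => //; apply: (hit z); rewrite // !inE.
Qed.

(** * The dual solution, in units of 1/10 *)

Definition share S x : nat := 4 - dg e S x.

Definition value S Y f : nat :=
  if f \subset S then \sum_(x in f) share S x else if f \in Y then 10 else 0.

Lemma value_inside S Y u v : u \in S -> v \in S -> e u v ->
  value S Y [set u; v] = share S u + share S v.
Proof.
move=> uS vS uv; rewrite /value subUset !sub1set uS vS /=.
by rewrite big_setU1 ?big_set1 // inE (e_neq e_irr uv).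
Qed.

Lemma set2_inj u : injective (fun x => [set u; x]).
Proof.
move=> x y E; have : x \in [set u; y] by rewrite -E !inE eqxx orbT.
have : y \in [set u; x] by rewrite E !inE eqxx orbT.
by rewrite !inE => /orP[] /eqP yE /orP[] /eqP xE; subst.
Qed.

Lemma degree_edges S x : x \in S ->
  #|[set f in edges G | (f \subset S) && (x \in f)]| = dg e S x.
Proof.
move=> xS; rewrite /dg -(card_imset _ (@set2_inj x)); apply: eq_card => f.
apply/idP/imsetP => [|[y]].
  rewrite in_set => /and3P[/edgesP[y [z [yz E]]] fS xf].
  move: fS xf; rewrite E subUset !sub1set !inE => /andP[yS zS] /orP[] /eqP Ex; subst x.
    by exists z; rewrite // in_nb zS.
  by exists y; rewrite 1?setUC // in_nb yS e_sym.
rewrite in_nb => /andP[yS xy ->].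
by rewrite in_set in_edges xy subUset !sub1set xS yS !inE eqxx.
Qed.

(** A vertex of degree d contributes its share to d edges, and 15 * d * (4 - d) is 0, 60, 45 for d =
    0, 2, 3, the value of [phi d d]. *)
Lemma value_sum S Y : (forall x, x \in S -> dg e S x \in [:: 0; 2; 3]) ->
  15 * \sum_(f in edges G) value S Y f <= 150 * #|Y| + pot e S S.
Proof.
move=> Sd; rewrite (bigID (fun f => f \subset S)) /= mulnDr addnC leq_add //.
  rewrite -[150]/(15 * 10) -mulnA leq_mul2l /= mulnC -sum_nat_const.
  rewrite big_mkcond [X in _ <= X]big_mkcond /=; apply: leq_sum => f _.
  by rewrite /value; case: (f \in edges G); case: (f \subset S); case: (f \in Y).
have -> : \sum_(f in edges G | f \subset S) value S Y f
    = \sum_(x in S) share S x * dg e S x.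
  transitivity (\sum_(f in edges G | f \subset S) \sum_(x in S | x \in f) share S x).
    apply: eq_bigr => f /andP[_ fS]; rewrite /value fS; apply: eq_bigl => x.
    by case xf: (x \in f); rewrite ?andbF // (subsetP fS).
  rewrite (exchange_big_dep (mem S)) /=; last by move=> f x _ /andP[].
  apply: eq_bigr => x xS; rewrite -(degree_edges xS) mulnC -sum_nat_const.
  by apply: eq_bigl => f; rewrite in_set xS /= andbA.
rewrite big_distrr /=; apply: leq_sum => x /Sd; rewrite /share !inE.
by case/or3P=> /eqP->.
Qed.

(** Inside [S] each end contributes its own share on the edge itself and at least its share plus 1
    on each other edge: 2 + 3 for degree 2, 1 + 2 + 2 for degree 3, so 5 per end. Outside [S] an
    edge of [Y] provides 10. *)
Lemma value_cover S Y f : (forall x, x \in S -> dg e S x \in [:: 0; 2; 3]) ->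
  touching S Y -> f \in edges G -> 10 <= \sum_(g in edelta f) value S Y g.
Proof.
move=> Sd [Ye YS Yt] fe.
have [fS|fS] := boolP (f \subset S); last first.
  have [g gY fg] := Yt _ fe fS.
  have gf : g \in edelta f.
    case/pred0Pn: fg => x /andP[/= xf xg]; apply/bigcupP; exists x => //.
    by rewrite inE (subsetP Ye).
  by rewrite (bigD1 g) //= {1}/value (negbTE (YS _ gY)) gY leq_addr.
have [u [v [uv E]]] := edgesP _ fe; subst f.
move: fS; rewrite subUset !sub1set => /andP[uS vS].
have vu : e v u by rewrite e_sym.
have nuv := e_neq e_irr uv.
have share1 x y : x \in S -> y \in S -> e x y ->
    [/\ 1 <= share S x & (dg e S x).-1 * (share S x).+1 + share S x = 5].
  move=> xS yS xy; have : 0 < dg e S x.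
    by rewrite card_gt0; apply/set0Pn; exists y; rewrite inE yS.
  by rewrite /share; have := Sd _ xS; rewrite !inE => /or3P[] /eqP->.
pose star x y := [set [set x; z] | z in nb e S x :\ y].
have star_sum x y : x \in S -> y \in S -> e x y ->
    (dg e S x).-1 * (share S x).+1 <= \sum_(g in star x y) value S Y g.
  move=> xS yS xy; rewrite big_imset; last by move=> ? ? _ _; apply: set2_inj.
  have -> : (dg e S x).-1 = #|nb e S x :\ y|.
    by rewrite /dg (cardsD1 y) inE yS xy.
  rewrite -sum_nat_const /=; apply: leq_sum => z; rewrite !inE => /and3P[_ zS xz].
  rewrite value_inside // -addn1 leq_add2l.
  by have [] := share1 z x zS xS; rewrite // e_sym.
(* The other edges at the two ends may be added up without counting any edge twice. *)
have disj : [disjoint star u v & star v u].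
  apply/pred0Pn => -[g /= /andP[/imsetP[x + ->] /imsetP[y + E]]].
  rewrite !inE => /andP[xv _] _.
  have : v \in [set u; x] by rewrite E !inE eqxx.
  by rewrite !inE eq_sym (negbTE nuv) eq_sym (negbTE xv).
have star_sub x y : x \in S -> y \in S -> e x y -> x \in [set u; v] ->
    star x y \subset edelta [set u; v] :\ [set x; y].
  move=> xS yS xy xuv; apply/subsetP => g /imsetP[z + ->].
  rewrite !inE => /and3P[zy zS xz]; rewrite (inj_eq (@set2_inj x)) zy /=.
  by apply/bigcupP; exists x => //; rewrite inE in_edges xz !inE eqxx.
rewrite (big_setD1 [set u; v]) /=; last first.
  by apply/bigcupP; exists u; [rewrite !inE eqxx | rewrite in_set in_edges uv !inE eqxx].
rewrite value_inside //.
have [_ Eu] := share1 u v uS vS uv; have [_ Ev] := share1 v u vS uS vu.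
have := star_sum u v uS vS uv; have := star_sum v u vS uS vu.
suff : \sum_(g in star u v) value S Y g + \sum_(g in star v u) value S Y g
    <= \sum_(g in edelta [set u; v] :\ [set u; v]) value S Y g.
  move: Eu Ev; move: (_ * _) (_ * _) => a b; move: (share S u) (share S v) => c d.
  move=> bc ad le le_a le_b; have := leq_trans (leq_add le_b le_a) le.
  rewrite -(leq_add2l (c + d)); apply: leq_trans.
  by move: bc ad; clear; lia.
have sA : star u v \subset edelta [set u; v] :\ [set u; v].
  by rewrite star_sub ?inE ?eqxx.
have sB : star v u \subset (edelta [set u; v] :\ [set u; v]) :\: star u v.
  rewrite subsetD disjoint_sym disj andbT.
  by rewrite [X in _ :\ X]setUC star_sub ?inE ?eqxx ?orbT.
rewrite [X in _ <= X](big_setID (star u v)) /= (setIidPr sA) leq_add2l.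
by rewrite [X in _ <= X](big_setID (star v u)) /= (setIidPr sB) leq_addr.
Qed.

End Solution.

(** * The program *)

Definition tnot t := TIf t (TC 0) (TC 1).
Definition tand t1 t2 := TIf t1 t2 (TC 0).
Definition tor t1 t2 := TIf t1 (TC 1) t2.
Definition teq t1 t2 := tnot (TAdd (TSub t1 t2) (TSub t2 t1)).
Definition tall t := tnot (TSum (tnot t)).

(** Multiplication is missing, but summing a constant over the n loop values multiplies it by n. The
    offset 2 skips the length of the word and the order of the graph. *)
Definition tadj i j := TGet 0 (TAdd (TC 2) (TAdd (TSum (TV i)) (TV j))).
Definition talive a i := tnot (TGet a (TV i)).
(** This is k n^2, the size of [k] matrices; the offset 1 in [tpos] skips the length cell of the
    output. *)
Definition tsquare k := iter k (TAdd (TSum (TSum (TC 1)))) (TC 0).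
Definition tpos k i j :=
  TAdd (TC 1) (TAdd (tsquare k) (TAdd (TSum (TV i)) (TV j))).

Definition mark k i j c :=
  PSeq (PSet 1 (tpos k i j) (TC c)) (PSet 1 (tpos k j i) (TC c)).
(** [d] is the level of the loop variable of this loop, so it has to equal the number of enclosing
    loops. *)
Definition kill d i j :=
  PFor (PIf (tor (tadj i d) (tadj j d)) (PSet 4 (TV d) (TC 1))).

Definition holds s env t : bool := den s env t != 0.

Lemma holds_not s env t : holds s env (tnot t) = ~~ holds s env t.
Proof. by rewrite /holds /=; case: ifP. Qed.

Lemma holds_and s env t1 t2 :
  holds s env (tand t1 t2) = holds s env t1 && holds s env t2.
Proof. by rewrite /holds /=; case: ifP. Qed.

Lemma holds_or s env t1 t2 :
  holds s env (tor t1 t2) = holds s env t1 || holds s env t2.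
Proof. by rewrite /holds /=; case: ifP. Qed.

Lemma holds_eq s env t1 t2 :
  holds s env (teq t1 t2) = (den s env t1 == den s env t2).
Proof. by rewrite holds_not /holds /=; lia. Qed.

(** * Fixed points of nested search loops *)

Section Loops.
Variables (n : nat) (Inv : store -> Prop) (mu : store -> nat).
Hypothesis Inv_n : forall s, Inv s -> s 0 1 = n.

Lemma run_for_fix s env p : Inv s ->
  (forall i, i < n -> run s (rcons env i) p = s) -> run s env (PFor p) = s.
Proof.
move=> Is fixs; rewrite /= (Inv_n Is).
have : forall i, i \in iota 0 n -> run s (rcons env i) p = s.
  by move=> i; rewrite mem_iota => /andP[_ /fixs].
by elim: (iota 0 n) => //= i l IHl H; rewrite H ?mem_head // IHl // => j jl;
  rewrite H // inE jl orbT.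
Qed.

Definition shrinks s env p := mu (run s env p) < mu s \/ run s env p = s.

(** If the measure never falls, the store never changes, so every iteration was idle on the initial
    store itself. *)
Lemma run_for_shrinks s env p : Inv s ->
    (forall i s, i < n -> Inv s ->
       Inv (run s (rcons env i) p) /\ shrinks s (rcons env i) p) ->
  Inv (run s env (PFor p)) /\
  (mu (run s env (PFor p)) < mu s \/
   run s env (PFor p) = s /\ forall i, i < n -> run s (rcons env i) p = s).
Proof.
move=> Is step; rewrite /= (Inv_n Is).
have : forall i s, i \in iota 0 n -> Inv s ->
    Inv (run s (rcons env i) p) /\ shrinks s (rcons env i) p.
  by move=> i s1; rewrite mem_iota => /andP[_ /step]; apply.
suff H l s1 : Inv s1 -> (forall i s, i \in l -> Inv s ->
      Inv (run s (rcons env i) p) /\ shrinks s (rcons env i) p) ->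
    Inv (foldl (fun s i => run s (rcons env i) p) s1 l) /\
    (mu (foldl (fun s i => run s (rcons env i) p) s1 l) < mu s1 \/
     foldl (fun s i => run s (rcons env i) p) s1 l = s1 /\
     forall i, i \in l -> run s1 (rcons env i) p = s1).
  move/(H _ _ Is) => [I1 [lt|[E fixs]]]; split=> //; [by left|right].
  by split=> // i lti; rewrite fixs // mem_iota.
elim: l s1 => [|i l IHl] s1 I1 stepl /=; first by split=> //; right.
have [I2 sh] := stepl i s1 (mem_head _ _) I1.
have [|I3 H] := IHl _ I2.
  by move=> j s2 jl; apply: stepl; rewrite inE jl orbT.
split=> //; case: sh => [lt|E].
  left; case: H => [lt'|[-> _]] //; exact: ltn_trans lt' lt.
rewrite E in H *; case: H => [lt|[E' fixs]]; [by left | right].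
by split=> // j; rewrite inE => /orP[/eqP->|/fixs].
Qed.

Definition nest m p := iter m PFor p.

Definition tuples m ts := (size ts == m) && all (fun i => i < n) ts.

Lemma tuples_cons m i ts : i < n -> tuples m ts -> tuples m.+1 (i :: ts).
Proof. by rewrite /tuples /= eqSS => -> /andP[-> ->]. Qed.

Lemma run_nest_fix m p env s : Inv s ->
  (forall ts, tuples m ts -> run s (env ++ ts) p = s) -> run s env (nest m p) = s.
Proof.
move=> Is; elim: m env => [|m IHm] env fixs.
  by have := fixs [::]; rewrite cats0; apply.
apply: run_for_fix => // i lti; apply: IHm => ts tsm.
by rewrite cat_rcons; apply/fixs/tuples_cons.
Qed.

Lemma run_nest_shrinks m p env :
    (forall ts s, tuples m ts -> Inv s ->
      Inv (run s (env ++ ts) p) /\ shrinks s (env ++ ts) p) ->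
  forall s, Inv s ->
  Inv (run s env (nest m p)) /\
  (mu (run s env (nest m p)) < mu s \/
   run s env (nest m p) = s /\ forall ts, tuples m ts -> run s (env ++ ts) p = s).
Proof.
elim: m env => [|m IHm] env step s Is.
  have := step [::] s; rewrite cats0 => -[] // I1 [lt|E]; split=> //; [by left|right].
  by split=> // -[|//]; rewrite cats0.
have IH i : i < n -> forall s, Inv s ->
    Inv (run s (rcons env i) (nest m p)) /\
    (mu (run s (rcons env i) (nest m p)) < mu s \/
     run s (rcons env i) (nest m p) = s /\
     forall ts, tuples m ts -> run s (rcons env i ++ ts) p = s).
  move=> lti; apply: IHm => ts s1 tsm I1; rewrite cat_rcons.
  by apply: step => //; apply: tuples_cons.
have [|I1 H] := @run_for_shrinks s env (nest m p) Is.
  move=> i s1 lti I1; have [I2 H] := IH i lti s1 I1.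
  by split=> //; case: H => [|[]]; [left|right].
split=> //; case: H => [lt|[E fixs]]; [by left|right; split=> //].
case=> [|i ts] //; rewrite /tuples /= eqSS => /and3P[ms lti tsn].
have [_ [|[_ H]]] := IH i lti s Is; first by rewrite fixs // ltnn.
by rewrite -cat_rcons H // /tuples ms tsn.
Qed.

(* Since each round that changes the store decreases the measure, n rounds    *)
(* reach a fixed point.                                                       *)
Lemma run_rounds m t p (test : store -> seq nat -> bool) :
    (forall i ts s, tuples m ts -> Inv s -> holds s (i :: ts) t = test s ts) ->
    (forall i ts s, tuples m ts -> Inv s -> test s ts ->
       Inv (run s (i :: ts) p) /\ mu (run s (i :: ts) p) < mu s) ->
  forall s, Inv s -> mu s <= n ->
  let s' := run s [::] (PFor (nest m (PIf t p))) in
  Inv s' /\ forall ts, tuples m ts -> ~~ test s' ts.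
Proof.
move=> testE step s Is mun.
pose Q s' := forall ts, tuples m ts -> ~~ test s' ts.
have round i s1 : Inv s1 -> Inv (run s1 [:: i] (nest m (PIf t p))) /\
    (mu (run s1 [:: i] (nest m (PIf t p))) < mu s1 \/
     run s1 [:: i] (nest m (PIf t p)) = s1 /\ Q s1).
  move=> I1; have [|I2 H] := @run_nest_shrinks m (PIf t p) [:: i] _ s1 I1.
    move=> ts s2 tsm I2; rewrite /shrinks /= -/(holds _ _ _) testE //.
    case: ifP => [tst|_]; last by split=> //; right.
    by have [I3 lt] := step i ts s2 tsm I2 tst; split=> //; left.
  split=> //; case: H => [|[E fixs]]; [by left|right; split=> // ts tsm].
  have := fixs ts tsm; rewrite /= -/(holds _ _ _) testE //; case: ifP => // tst E'.
  by have [_] := step i ts s1 tsm I1 tst; rewrite E' ltnn.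
have stay i s1 : Inv s1 -> Q s1 -> run s1 [:: i] (nest m (PIf t p)) = s1.
  move=> I1 Q1; apply: run_nest_fix => // ts tsm.
  by rewrite /= -/(holds _ _ _) testE // (negbTE (Q1 _ tsm)).
move=> /=; rewrite (Inv_n Is).
have : Inv (foldl (fun s i => run s [:: i] (nest m (PIf t p))) s (iota 0 n)) /\
    (Q (foldl (fun s i => run s [:: i] (nest m (PIf t p))) s (iota 0 n)) \/
     mu (foldl (fun s i => run s [:: i] (nest m (PIf t p))) s (iota 0 n)) + n <= mu s).
  elim: n => [|k [Ik Hk]]; first by split=> //; right; rewrite addn0.
  rewrite iota0S foldl_rcons; set sk := foldl _ _ _ in Ik Hk *.
  have [I1 H] := round k sk Ik; split=> //.
  case: Hk => [Qk|lek]; first by left; rewrite stay.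
  by case: H => [lt|[-> Qk]]; [right; lia | left].
set s' := foldl _ _ _; case=> I' [//|le]; split=> // ts tsm.
(* In the remaining case the measure fell in each of the n rounds and is 0, so no test can succeed:
   its step would lower the measure. The round number 0 is arbitrary. *)
apply/negP => tst; have [_] := step 0 ts s' tsm I' tst.
by rewrite ltnNge; move: le mun; clear; lia.
Qed.

End Loops.

(* Level 0 is the round; in the first phase levels 1 to 6 are u, v, p, q, r,  *)
(* s of [reducible]. Array 4 flags the vertices removed so far, and array 5   *)
(* those removed by the first phase.                                          *)
Definition thit x :=
  tor (teq (TV x) (TV 3)) (tor (teq (TV x) (TV 4))
    (tor (teq (TV x) (TV 5)) (teq (TV x) (TV 6)))).

Definition test1 :=
  tand (tand (talive 4 1) (tand (talive 4 2) (tadj 1 2)))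
  (tand (tand (talive 4 3) (tand (talive 4 4)
          (tand (tadj 3 4) (tor (tadj 1 3) (tadj 2 3)))))
  (tand (tand (talive 4 5) (tand (talive 4 6)
          (tand (tadj 5 6) (tor (tadj 1 5) (tadj 2 5)))))
    (tall (tall (tor
       (tnot (tand (talive 4 7) (tand (talive 4 8)
          (tand (tadj 7 8) (tor (tadj 1 7) (tadj 2 7))))))
       (tor (thit 7) (thit 8))))))).

Definition phase1 := PFor (nest 6 (PIf test1
  (PSeq (mark 0 1 2 1) (PSeq (mark 1 3 4 10)
    (PSeq (mark 1 5 6 10) (kill 7 1 2)))))).

Definition copy := PFor (PSet 5 (TV 0) (TGet 4 (TV 0))).

Definition tdeg (alive : nat -> term) x y := TSum (tand (tadj x y) (alive y)).

(** All pairs of remaining vertices are written, adjacent or not, since only entries at edges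
    matter. Edges of Y are not among them and keep the numerator 10. *)
Definition weights := nest 2 (PIf (tand (talive 4 0) (talive 4 1))
  (PSet 1 (tpos 1 0 1)
    (TAdd (TSub (TC 4) (tdeg (talive 4) 0 2)) (TSub (TC 4) (tdeg (talive 4) 1 2))))).

Definition tphi d0 d :=
  TIf d (TIf (TSub d (TC 1)) (TIf (TSub d (TC 2)) (TC 45)
    (TIf (teq d0 (TC 2)) (TC 60) (TC 50))) (TC 42)) (TC 0).

(** The levels 3 and 4 are fixed because the potential is evaluated only below the three loops of
    [phase2]. *)
Definition tpot (alive : nat -> term) :=
  TSum (TIf (alive 3) (tphi (tdeg (talive 5) 3 4) (tdeg alive 3 4)) (TC 0)).

Definition tsurvives x :=
  tand (talive 4 x) (tand (tnot (tadj 1 x)) (tnot (tadj 2 x))).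

(** Truncated subtraction gives 0 exactly if the old potential is at most the new one plus 350. *)
Definition test2 :=
  tand (tand (talive 4 1) (tand (talive 4 2) (tadj 1 2)))
    (tnot (TSub (tpot (talive 4)) (TAdd (tpot tsurvives) (TC 350)))).

Definition phase2 :=
  PFor (nest 2 (PIf test2 (PSeq (mark 0 1 2 1) (kill 3 1 2)))).

Definition conclude :=
  PSeq (nest 2 (PIf (TC 1) (PSet 1 (tpos 2 0 1) (TC 10))))
    (PSet 1 (TC 0) (tsquare 3)).

Definition program :=
  PSeq phase1 (PSeq copy (PSeq weights (PSeq phase2 conclude))).

Lemma program_wf : wfp 0 program. Proof. by []. Qed.

Lemma nth_flatten_uniform (T : Type) (x0 : T) (ss : seq (seq T)) m i j :
  all (fun s => size s == m) ss -> i < size ss -> j < m ->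
  nth x0 (flatten ss) (i * m + j) = nth x0 (nth [::] ss i) j.
Proof.
elim: ss i => // s ss IHss i /= /andP[/eqP sm ssm] lti ltj; rewrite nth_cat sm.
case: i lti => [|i] lti; first by rewrite mul0n add0n ltj.
by rewrite mulSn -addnA ltnNge leq_addr addKn IHss.
Qed.

(** * Meaning of the program on an encoded graph *)

Section Run.
Variable G : sgraph.
Local Notation n := (Defs.order G).
Local Notation e := (@adj G).
Local Notation e_sym := (@adj_sym G).
Implicit Types (s : store) (u v x y : vertex G).

Lemma size_encode_graph : size (encode_graph G) = (n * n).+1.
Proof. by rewrite /= size_allpairs -cardE card_ord. Qed.

Lemma input_adj u v : input (encode_graph G) 0 (2 + (n * u + v)) = e u v.
Proof.
rewrite /input eqxx add2n [nth _ _ _]/= mulnC.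
rewrite (@nth_flatten_uniform _ _ _ n).
- rewrite (nth_map u) ?size_enum_ord // (nth_map u) ?size_enum_ord //.
  by rewrite !nth_ord_enum.
- by apply/allP => s /mapP[x _ ->]; rewrite size_map size_enum_ord.
- by rewrite size_map size_enum_ord.
exact: ltn_ord.
Qed.

Definition reads s := s 0 = input (encode_graph G) 0.

Lemma reads_order s : reads s -> s 0 1 = n.
Proof. by move=> ->. Qed.

Lemma den_row s env i u : reads s -> i < size env -> nth 0 env i = u ->
  den s env (TSum (TV i)) = n * u.
Proof.
move=> rs lti Eu /=; rewrite (reads_order rs) (eq_big_nat _ _ (F2 := fun=> u :> nat)).
  by rewrite sum_nat_const_nat subn0.
by move=> k _; rewrite nth_rcons lti Eu.
Qed.

Lemma den_adj s env i j u v : reads s -> i < size env ->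
  nth 0 env i = u -> nth 0 env j = v -> den s env (tadj i j) = e u v.
Proof.
move=> rs lti Eu Ev; rewrite -input_adj -rs -(den_row rs lti Eu).
by cbn [den tadj]; rewrite Ev.
Qed.

Definition alive a s : {set vertex G} :=
  [set x : vertex G | s a x == 0].

Lemma holds_alive s env a i x : nth 0 env i = x ->
  holds s env (talive a i) = (x \in alive a s).
Proof. by move=> Ex; rewrite holds_not /holds /= Ex inE negbK. Qed.

Lemma holds_adj s env i j u v : reads s -> i < size env ->
  nth 0 env i = u -> nth 0 env j = v -> holds s env (tadj i j) = e u v.
Proof. by move=> rs lti Eu Ev; rewrite /holds (den_adj rs lti Eu Ev); case: e. Qed.

Lemma holds_all s env t : reads s ->
  holds s env (tall t) = [forall x : vertex G, holds s (rcons env x) t].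
Proof.
move=> rs; rewrite /tall holds_not /holds negbK; cbn [den].
rewrite (reads_order rs) big_mkord sum_nat_eq0; apply: eq_forallb => x /=.
by case: ifP.
Qed.

Definition pos k (u v : nat) := 1 + (k * n ^ 2 + (u * n + v)).

Lemma den_square s env k : reads s -> den s env (tsquare k) = k * n ^ 2.
Proof.
move=> rs; elim: k => // k /= ->.
by rewrite (reads_order rs) !sum_nat_const_nat !subn0 muln1 mulSn -mulnn.
Qed.

Lemma den_pos s env k i j u v : reads s -> i < size env ->
  nth 0 env i = u -> nth 0 env j = v -> den s env (tpos k i j) = pos k u v.
Proof.
move=> rs lti Eu Ev; have := den_row rs lti Eu; cbn [den tpos] => ->.
by rewrite den_square // Ev /pos [n * u]mulnC.
Qed.

(** Uniqueness of division with remainder, first by n^2 and then by n. *)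
Lemma pos_inj k u v k' u' v' : pos k u v = pos k' u' v' ->
  [/\ k = k', u = u' :> nat & v = v' :> nat].
Proof.
have lt_n2 (x y : vertex G) : x * n + y < n ^ 2.
  by have := ltn_ord x; have := ltn_ord y; rewrite -mulnn; nia.
have divide m a b c d : b < m -> d < m -> a * m + b = c * m + d -> a = c /\ b = d.
  by move=> bm dm E; have := edivn_eq a bm; rewrite E edivn_eq // => -[-> ->].
move/eqP; rewrite eqn_add2l => /eqP E.
have [-> {}E] := divide _ _ _ _ _ (lt_n2 u v) (lt_n2 u' v') E.
by have [-> ->] := divide _ _ _ _ _ (ltn_ord v) (ltn_ord v') E.
Qed.

Definition entry s k u v := s 1 (pos k u v).

Lemma entry_update s k k' u v u' v' c :
  entry (update s 1 (pos k u v) c) k' u' v' =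
  if [&& k' == k, u' == u & v' == v] then c else entry s k' u' v'.
Proof.
rewrite /entry /update eqxx /=; have [/pos_inj[-> Eu Ev]|ne] := eqVneq.
  by rewrite (val_inj Eu) (val_inj Ev) !eqxx.
by case: ifP => // /and3P[/eqP Ek /eqP Eu /eqP Ev]; rewrite Ek Eu Ev eqxx in ne.
Qed.

Lemma set2_eq u v x y : ([set x; y] == [set u; v]) =
  ((x == u) && (y == v)) || ((x == v) && (y == u)).
Proof.
apply/eqP/idP => [E|/orP[]/andP[/eqP-> /eqP->] //]; last exact: setUC.
have : x \in [set u; v] by rewrite -E !inE eqxx.
have : y \in [set u; v] by rewrite -E !inE eqxx orbT.
have : u \in [set x; y] by rewrite E !inE eqxx.
have : v \in [set x; y] by rewrite E !inE eqxx orbT.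
rewrite !inE ![u == _]eq_sym ![v == _]eq_sym.
by case: (x == u); case: (y == u); case: (x == v); case: (y == v).
Qed.

Lemma run_mark s env k i j c u v : reads s -> i < size env -> j < size env ->
  nth 0 env i = u -> nth 0 env j = v ->
  let s' := run s env (mark k i j c) in
  (forall a, a != 1 -> s' a = s a) /\
  forall k' x y, entry s' k' x y =
    if (k' == k) && ([set x; y] == [set u; v]) then c else entry s k' x y.
Proof.
move=> rs lti ltj Eu Ev; cbn [run mark]; rewrite (den_pos k rs lti Eu Ev).
set s1 := update s 1 _ _.
have rs1 : reads s1 by [].
rewrite (den_pos k rs1 ltj Ev Eu) /=; split=> [a na|k' x y].
  by apply: functional_extensionality => b; rewrite /s1 /update (negbTE na).
rewrite !entry_update set2_eq.
by case: (k' == k); case: (x == u); case: (x == v); case: (y == u); case: (y == v).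
Qed.

Lemma run_for_ind (I : nat -> store -> Prop) s env p m : s 0 1 = m -> I 0 s ->
  (forall i s, i < m -> I i s -> I i.+1 (run s (rcons env i) p)) ->
  I m (run s env (PFor p)).
Proof.
move=> sm I0 step /=; rewrite sm.
have : forall k, k <= m ->
    I k (foldl (fun s i => run s (rcons env i) p) s (iota 0 k)).
  elim=> [|k IHk] lk //; rewrite iota0S foldl_rcons; apply: step => //.
  by apply: IHk; apply: ltnW.
by apply.
Qed.

Lemma run_kill s env i j u v : reads s -> i < size env -> j < size env ->
  nth 0 env i = u -> nth 0 env j = v ->
  let s' := run s env (kill (size env) i j) in
  (forall a, a != 4 -> s' a = s a) /\ alive 4 s' = rest e (alive 4 s) u v.
Proof.
move=> rs lti ltj Eu Ev s'.
pose I k s1 := (forall a, a != 4 -> s1 a = s a) /\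
  forall x, s1 4 x = if (x < k) && (e u x || e v x) then 1 else s 4 x.
have [I1 I2] : I n s'.
  apply: run_for_ind => [||k s1 ltk [sa s4]]; first exact: reads_order.
    by split.
  have rs1 : reads s1 by rewrite /reads sa.
  pose x := Ordinal ltk.
  have nu : nth 0 (rcons env k) i = u by rewrite nth_rcons lti.
  have nv : nth 0 (rcons env k) j = v by rewrite nth_rcons ltj.
  have nx : nth 0 (rcons env k) (size env) = x by rewrite nth_rcons ltnn eqxx.
  have szi : i < size (rcons env k) by rewrite size_rcons ltnW.
  have szj : j < size (rcons env k) by rewrite size_rcons ltnW.
  cbn [run]; rewrite -/(holds _ _ _) holds_or.
  rewrite (holds_adj rs1 szi nu nx) (holds_adj rs1 szj nv nx).
  case: ifP => [adj|nadj].
    split=> [a na|y]; first by rewrite -sa //; apply: functional_extensionality => b;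
      rewrite /update (negbTE na).
    rewrite /update eqxx [den _ _ _]/= nx s4 ltnS [in RHS]leq_eqVlt.
    rewrite -![_ == val x]/(y == x); case: (y =P x) => [->|_] //=.
    by rewrite adj.
  split=> // y; rewrite s4 ltnS [in RHS]leq_eqVlt -[val y == k]/(y == x).
  by case: (y =P x) => [->|//]; rewrite nadj !andbF.
split=> //; apply/setP => x; rewrite !inE I2 ltn_ord /=.
by case: (e u x); case: (e v x); rewrite ?andbT ?andbF.
Qed.


Lemma den_not s env t : den s env (tnot t) = ~~ holds s env t :> nat.
Proof. by rewrite /holds /=; case: ifP. Qed.

Lemma den_and s env t1 t2 :
  den s env (tand t1 t2) = if holds s env t1 then den s env t2 else 0.
Proof. by []. Qed.

Lemma den_alive s env a i x : nth 0 env i = x ->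
  den s env (talive a i) = (x \in alive a s) :> nat.
Proof. by move=> Ex; rewrite den_not /holds /= Ex inE negbK. Qed.

Lemma den_deg s env (al : nat -> term) (A : {set vertex G}) i x :
  reads s -> i < size env -> nth 0 env i = x ->
  (forall y, den s (rcons env y) (al (size env)) = (y \in A) :> nat) ->
  den s env (tdeg al i (size env)) = dg e A x.
Proof.
move=> rs lti Ex Aal; cbn [den tdeg]; rewrite (reads_order rs) big_mkord.
rewrite /dg -sum1_card [RHS]big_mkcond /=; apply: eq_bigr => y _.
have nx : nth 0 (rcons env y) i = x by rewrite nth_rcons lti.
have ny : nth 0 (rcons env y) (size env) = y by rewrite nth_rcons ltnn eqxx.
have sz : i < size (rcons env y) by rewrite size_rcons ltnW.
rewrite -[X in X != 0]/(den s (rcons env y) (tadj i (size env))).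
rewrite (den_adj rs sz nx ny) Aal inE.
by case: (e x y); case: (y \in A).
Qed.

Lemma den_phi s env t0 t :
  den s env (tphi t0 t) = phi (den s env t0) (den s env t).
Proof.
have E : (den s env (teq t0 (TC 2)) != 0) = (den s env t0 == 2).
  exact: holds_eq.
cbn [den tphi]; rewrite {}E.
move: (den s env t0) (den s env t) => a b; case: b => [|[|[|b]]];
  by rewrite /phi /=; do ?[case: ifP => ?]; lia.
Qed.

Lemma den_pot s i u v (al : nat -> term) (A : {set vertex G}) : reads s ->
  (forall x, den s [:: i; val u; val v; val x] (al 3) = (x \in A) :> nat) ->
  (forall x y, den s [:: i; val u; val v; val x; val y] (al 4) = (y \in A) :> nat) ->
  den s [:: i; val u; val v] (tpot al) = pot e (alive 5 s) A.
Proof.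
move=> rs A3 A4; cbn [den tpot]; rewrite (reads_order rs) big_mkord.
rewrite /pot [RHS]big_mkcond /=; apply: eq_bigr => x _.
rewrite A3; case: (x \in A); last by [].
rewrite -[LHS]/(den s [:: i; val u; val v; val x]
  (tphi (tdeg (talive 5) 3 4) (tdeg al 3 4))) den_phi.
rewrite (@den_deg s [:: i; val u; val v; val x] _ (alive 5 s) 3 x) //; last first.
  by move=> y; apply: den_alive.
by rewrite (@den_deg s [:: i; val u; val v; val x] _ A 3 x) // => y; apply: A4.
Qed.

Lemma test2E s i u v : reads s ->
  holds s [:: i; val u; val v] test2 =
  [&& [&& u \in alive 4 s, v \in alive 4 s & e u v]
    & pot e (alive 5 s) (alive 4 s)
      <= pot e (alive 5 s) (rest e (alive 4 s) u v) + 350].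
Proof.
move=> rs; rewrite /test2 !holds_and [holds _ _ (tnot (TSub _ _))]holds_not.
rewrite (@holds_alive s _ 4 1 u) // (@holds_alive s _ 4 2 v) //.
rewrite (@holds_adj s _ 1 2 u v) //; congr (_ && _).
rewrite /holds negbK; cbn [den].
rewrite -[X in X - _]/(den s _ (tpot (talive 4))).
rewrite -[X in _ - (X + _)]/(den s _ (tpot tsurvives)).
rewrite (@den_pot _ _ _ _ _ (alive 4 s)) //.
- rewrite (@den_pot _ _ _ _ _ (rest e (alive 4 s) u v)) //.
  + move=> x; rewrite /tsurvives !den_and den_not.
    rewrite (@holds_alive s _ 4 3 x) // holds_not (@holds_adj s _ 1 3 u x) //.
    rewrite (@holds_adj s _ 2 3 v x) // [x \in rest _ _ _ _]inE.
    by case: (x \in alive 4 s); case: (e u x).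
  move=> y x; rewrite /tsurvives !den_and den_not.
  rewrite (@holds_alive s _ 4 4 x) // holds_not (@holds_adj s _ 1 4 u x) //.
  rewrite (@holds_adj s _ 2 4 v x) // [x \in rest _ _ _ _]inE.
  by case: (x \in alive 4 s); case: (e u x).
- by move=> x; apply: den_alive.
by move=> x y; apply: den_alive.
Qed.

Lemma test1E s i u v p q r t : reads s ->
  holds s [:: i; val u; val v; val p; val q; val r; val t] test1 =
  reducible (alive 4 s) u v p q r t.
Proof.
move=> rs; rewrite /test1 !holds_and !holds_or.
rewrite (@holds_alive s _ 4 1 u) // (@holds_alive s _ 4 2 v) //.
rewrite (@holds_alive s _ 4 3 p) // (@holds_alive s _ 4 4 q) //.
rewrite (@holds_alive s _ 4 5 r) // (@holds_alive s _ 4 6 t) //.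
rewrite (@holds_adj s _ 1 2 u v) // (@holds_adj s _ 3 4 p q) //.
rewrite (@holds_adj s _ 1 3 u p) // (@holds_adj s _ 2 3 v p) //.
rewrite (@holds_adj s _ 5 6 r t) // (@holds_adj s _ 1 5 u r) //.
rewrite (@holds_adj s _ 2 5 v r) // /reducible; do 3!congr (_ && _).
rewrite holds_all //; apply: eq_forallb => x.
rewrite holds_all //; apply: eq_forallb => y.
rewrite holds_or holds_not !holds_and !holds_or.
rewrite (@holds_alive s _ 4 7 x) // (@holds_alive s _ 4 8 y) //.
rewrite (@holds_adj s _ 7 8 x y) // (@holds_adj s _ 1 7 u x) //.
by rewrite (@holds_adj s _ 2 7 v x) // implybE !holds_eq !inE.
Qed.

(** * The first phase, and the weights on what it leaves *)

Definition size_alive s : nat := #|alive 4 s|.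

Definition invariant1 s : Prop := reads s /\
  exists M Y : {set {set vertex G}},
    [/\ forall x y, entry s 0 x y = ([set x; y] \in M) :> nat,
        forall x y, entry s 1 x y = if [set x; y] \in Y then 10 else 0,
        separated (alive 4 s) M, touching (alive 4 s) Y & #|Y| <= 2 * #|M|].

Lemma rest_lt (S : {set vertex G}) u v : u \in S -> e v u ->
  #|rest e S u v| < #|S|.
Proof.
move=> uS vu; apply/proper_card/properP; split.
  by apply/subsetP => x; rewrite inE => /andP[].
by exists u; rewrite // inE vu !andbF.
Qed.

Lemma step1 s i u v p q r t : invariant1 s -> reducible (alive 4 s) u v p q r t ->
  let s' := run s [:: i; val u; val v; val p; val q; val r; val t]
    (PSeq (mark 0 1 2 1) (PSeq (mark 1 3 4 10)
      (PSeq (mark 1 5 6 10) (kill 7 1 2)))) in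
  invariant1 s' /\ size_alive s' < size_alive s.
Proof.
set env := [:: i; _; _; _; _; _; _].
case=> rs [M [Y [M0 Y1 sepM touchY leY]]] red.
have /and4P[/and3P[uS vS uv] _ _ _] := red.
have vu : e v u by rewrite e_sym.
move=> s'.
have [a1 E1] := @run_mark s env 0 1 2 1 u v rs erefl erefl erefl erefl.
set s1 := run _ _ _ in a1 E1.
have rs1 : reads s1 by rewrite /reads a1.
have [a2 E2] := @run_mark s1 env 1 3 4 10 p q rs1 erefl erefl erefl erefl.
set s2 := run _ _ _ in a2 E2.
have rs2 : reads s2 by rewrite /reads a2.
have [a3 E3] := @run_mark s2 env 1 5 6 10 r t rs2 erefl erefl erefl erefl.
set s3 := run _ _ _ in a3 E3.
have rs3 : reads s3 by rewrite /reads a3.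
have [a4 E4] := @run_kill s3 env 1 2 u v rs3 erefl erefl erefl erefl.
rewrite -[run _ _ _]/s' in a4 E4.
have S3 : alive 4 s3 = alive 4 s by rewrite /alive a3 // a2 // a1.
rewrite S3 in E4.
have ent k x y : entry s' k x y = entry s3 k x y by rewrite /entry a4.
split; last by rewrite /size_alive E4 rest_lt.
split; first by rewrite /reads a4.
have [sep uvM] := separated_step sepM uS vS uv.
exists ([set u; v] |: M), ([set p; q] |: ([set r; t] |: Y)); rewrite E4; split=> //.
- by move=> x y; rewrite ent E3 E2 E1 /= M0 in_setU1; case: eqP.
- move=> x y; rewrite ent E3 E2 E1 /= Y1 !in_setU1.
  by case: eqP; case: eqP.
- exact: touching_step.
have -> : #|[set u; v] |: M| = #|M|.+1 by rewrite cardsU1 uvM.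
rewrite !cardsU1; move: leY; clear.
by case: (_ \notin _); case: (_ \notin _); lia.
Qed.

Lemma alive_input : alive 4 (input (encode_graph G)) = setT.
Proof. by apply/setP => x; rewrite !inE. Qed.

Lemma invariant1_input : invariant1 (input (encode_graph G)).
Proof.
split=> //; exists set0, set0; rewrite alive_input.
split; [by move=> x y; rewrite inE | by move=> x y; rewrite inE | | | by rewrite cards0].
  exact: separated0.
exact: touching0.
Qed.

Lemma tuple2 ts : tuples n 2 ts -> exists u v, ts = [:: u : nat; v : nat].
Proof.
case: ts => [|a [|b []]] //; rewrite /tuples /= => /and3P[a_n b_n _].
by exists (Ordinal a_n), (Ordinal b_n).
Qed.

Lemma tuple6 ts : tuples n 6 ts ->
  exists u v (p q r t : vertex G), ts = [:: u : nat; v : nat; p : nat; q : nat; r : nat; t : nat].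
Proof.
case: ts => [|a [|b [|c [|d [|f [|g []]]]]]] //; rewrite /tuples /= => /and5P[a_n b_n c_n d_n].
case/and3P=> f_n g_n _.
by exists (Ordinal a_n), (Ordinal b_n), (Ordinal c_n), (Ordinal d_n),
  (Ordinal f_n), (Ordinal g_n).
Qed.

Lemma tuples_val (us : seq (vertex G)) : tuples n (size us) [seq nat_of_ord u | u <- us].
Proof. by rewrite /tuples size_map eqxx; apply/allP => _ /mapP[u _ ->] /=. Qed.

Lemma run_phase1 : let s := run (input (encode_graph G)) [::] phase1 in
  invariant1 s /\ forall u v p q r t, ~~ reducible (alive 4 s) u v p q r t.
Proof.
(* [insub] turns loop values back into vertices; on tuples of numbers below n nothing is dropped. *)
pose test s ts := if pmap insub ts is [:: u; v; p; q; r; t]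
  then reducible (alive 4 s) u v p q r t else false.
have testE s u v (p q r t : vertex G) :
    test s [:: u : nat; v : nat; p : nat; q : nat; r : nat; t : nat] =
    reducible (alive 4 s) u v p q r t.
  by rewrite /test /= !valK.
have [|||||I H] := @run_rounds n invariant1 size_alive _ 6 test1
  (PSeq (mark 0 1 2 1) (PSeq (mark 1 3 4 10)
      (PSeq (mark 1 5 6 10) (kill 7 1 2)))) test _ _ (input (encode_graph G)).
- by move=> s [/reads_order].
- move=> i ts s /tuple6[u [v [p [q [r [t ->]]]]]] [rs _].
  by rewrite testE test1E.
- move=> i ts s /tuple6[u [v [p [q [r [t ->]]]]]] Is; rewrite testE.
  exact: step1.
- exact: invariant1_input.
- by rewrite /size_alive -[X in _ <= X]card_ord max_card.
split=> // u v p q r t.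
by rewrite -testE; apply: H (tuples_val [:: u; v; p; q; r; t]).
Qed.

Lemma run_copy s : reads s -> let s' := run s [::] copy in
  (forall a, a != 5 -> s' a = s a) /\ alive 5 s' = alive 4 s.
Proof.
move=> rs s'.
pose I k s1 := (forall a, a != 5 -> s1 a = s a) /\
  forall x, x < k -> s1 5 x = s 4 x.
have [I1 I2] : I n s'.
  apply: run_for_ind => // [|k s1 ltk [sa s5]]; first exact: reads_order.
  split=> [a na|x]; rewrite [run _ _ _]/=.
    by rewrite -sa //; apply: functional_extensionality => b;
      rewrite /update (negbTE na).
  rewrite ltnS leq_eqVlt /update /= => /orP[/eqP->|ltx]; first by rewrite eqxx sa.
  by rewrite (ltn_eqF ltx) s5.
by split=> //; apply/setP => x; rewrite !inE I2.
Qed.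

(** Test and value must be insensitive to array 1, which changes during the loops. *)
Lemma run_write s k t w (T : rel (vertex G)) (W : vertex G -> vertex G -> nat) :
    reads s ->
    (forall s1 x y, (forall a, a != 1 -> s1 a = s a) ->
       holds s1 [:: val x; val y] t = T x y) ->
    (forall s1 x y, (forall a, a != 1 -> s1 a = s a) -> T x y ->
       den s1 [:: val x; val y] w = W x y) ->
  let s' := run s [::] (nest 2 (PIf t (PSet 1 (tpos k 0 1) w))) in
  (forall a, a != 1 -> s' a = s a) /\
  forall k' x y, entry s' k' x y =
    if (k' == k) && T x y then W x y else entry s k' x y.
Proof.
move=> rs tE wE s'.
(* The pairs lexicographically before (i, j) have been treated. *)
pose I i j s1 := (forall a, a != 1 -> s1 a = s a) /\
  forall k' (x y : vertex G), entry s1 k' x y =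
    if [&& k' == k, (x < i) || (x == i :> nat) && (y < j) & T x y]
    then W x y else entry s k' x y.
have [I1 I2] : I n 0 s'.
  apply: (@run_for_ind (fun i => I i 0)) => [||i s1 lti [sa sE]].
  - exact: reads_order.
  - by split=> // k' x y; rewrite !ltn0 !andbF.
  have rs1 : reads s1 by rewrite /reads sa.
  have [I1 I2] : I i n (run s1 [:: i] (PFor (PIf t (PSet 1 (tpos k 0 1) w)))).
    apply: run_for_ind => [||j s2 ltj [s2a s2E]].
    - exact: reads_order.
    - by [].
    have rs2 : reads s2 by rewrite /reads s2a.
    pose x := Ordinal lti; pose y := Ordinal ltj.
    have step k' (x' y' : vertex G) :
        [&& k' == k, (x' < i) || (x' == i :> nat) && (y' < j.+1) & T x' y'] =
        [&& k' == k, (x' < i) || (x' == i :> nat) && (y' < j) & T x' y']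
        || [&& k' == k, x' == x, y' == y & T x' y'].
      rewrite ltnS [y' <= j]leq_eqVlt -[x' == i :> nat]/(x' == x) -[val y' == j]/(y' == y).
      by case: (k' == k); case: (x' < i); case: (x' == x); case: (y' == y);
        case: (y' < j); case: (T x' y').
    rewrite [rcons _ _]/=; cbn [run]; rewrite -/(holds _ _ _) (tE s2 x y) //.
    case: ifP => [Txy|nTxy]; last first.
      split=> // k' x' y'; rewrite step s2E; case: ifP => //= _.
      by case: ifP => // /and4P[_ /eqP-> /eqP->]; rewrite nTxy.
    rewrite (@den_pos s2 _ k 0 1 x y) // (wE s2 x y) //; split=> [a na|k' x' y'].
      by rewrite -s2a //; apply: functional_extensionality => b;
        rewrite /update (negbTE na).
    rewrite entry_update step s2E.
    case: (k' == k) => //=; case: (x' =P x) => [->|_] /=; last by rewrite orbF.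
    case: (y' =P y) => [->|_] /=; last by rewrite orbF.
    by rewrite Txy orbT.
  split=> // k' x y.
  by rewrite I2 ltn_ord andbT ltn0 andbF orbF ltnS [x <= i]leq_eqVlt orbC.
by split=> // k' x y; rewrite I2 ltn_ord.
Qed.

Lemma run_weights s : reads s -> let s' := run s [::] weights in
  (forall a, a != 1 -> s' a = s a) /\
  forall k x y, entry s' k x y =
    if (k == 1) && ((x \in alive 4 s) && (y \in alive 4 s))
    then share (alive 4 s) x + share (alive 4 s) y else entry s k x y.
Proof.
move=> rs; pose T x y := (x \in alive 4 s) && (y \in alive 4 s).
have [||a1 E1] := @run_write s 1 (tand (talive 4 0) (talive 4 1))
    (TAdd (TSub (TC 4) (tdeg (talive 4) 0 2)) (TSub (TC 4) (tdeg (talive 4) 1 2)))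
    T (fun x y => share (alive 4 s) x + share (alive 4 s) y) rs.
- move=> s1 x y sa; rewrite holds_and (@holds_alive s1 _ 4 0 x) //.
  by rewrite (@holds_alive s1 _ 4 1 y) // /alive sa.
- move=> s1 x y sa _; have rs1 : reads s1 by rewrite /reads sa.
  have S1 : alive 4 s1 = alive 4 s by rewrite /alive sa.
  rewrite -[LHS]/(4 - den s1 [:: x : nat; y : nat] (tdeg (talive 4) 0 2)
    + (4 - den s1 [:: x : nat; y : nat] (tdeg (talive 4) 1 2))).
  rewrite (@den_deg s1 [:: x : nat; y : nat] _ (alive 4 s1) 0 x) //; last first.
    by move=> z; apply: den_alive.
  rewrite (@den_deg s1 [:: x : nat; y : nat] _ (alive 4 s1) 1 y) //; last first.
    by move=> z; apply: den_alive.
  by rewrite S1.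
by split.
Qed.

Lemma run_conclude s : reads s -> let s' := run s [::] conclude in
  s' 1 0 = 3 * n ^ 2 /\
  forall k x y, entry s' k x y = if k == 2 then 10 else entry s k x y.
Proof.
move=> rs; have [||a1 E1] := @run_write s 2 (TC 1) (TC 10)
  (fun _ _ => true) (fun _ _ => 10) rs => //.
cbn [run conclude]; set s1 := run s [::] _ in a1 E1 *.
have rs1 : reads s1 by rewrite /reads a1.
rewrite den_square //=; split=> [|k x y]; first by rewrite /update !eqxx.
by rewrite -[entry (update _ _ _ _) k x y]/(entry s1 k x y) E1 andbT.
Qed.

(** * The second phase *)

Definition invariant2 (S0 : {set vertex G}) (m : nat)
    (b : vertex G -> vertex G -> nat) s : Prop :=
  [/\ reads s, alive 5 s = S0, forall x y, entry s 1 x y = b x y,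
      alive 4 s \subset S0
    & exists M : {set {set vertex G}},
      [/\ forall x y, entry s 0 x y = ([set x; y] \in M) :> nat,
          separated (alive 4 s) M
        & pot e S0 S0 + 350 * m <= pot e S0 (alive 4 s) + 350 * #|M|]].

Lemma step2 S0 m b s i u v : invariant2 S0 m b s -> good e S0 (alive 4 s) u v ->
  let s' := run s [:: i; u : nat; v : nat] (PSeq (mark 0 1 2 1) (kill 3 1 2)) in
  invariant2 S0 m b s' /\ size_alive s' < size_alive s.
Proof.
set env := [:: i; _; _].
case=> rs A5 E1b sub [M [M0 sepM le]] [uS vS uv drop].
have vu : e v u by rewrite e_sym.
move=> s'.
have [a1 E1] := @run_mark s env 0 1 2 1 u v rs erefl erefl erefl erefl.
set s1 := run _ _ _ in a1 E1.
have rs1 : reads s1 by rewrite /reads a1.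
have [a2 E2] := @run_kill s1 env 1 2 u v rs1 erefl erefl erefl erefl.
rewrite -[run _ _ _]/s' in a2 E2.
have S1 : alive 4 s1 = alive 4 s by rewrite /alive a1.
rewrite S1 in E2.
have ent k x y : entry s' k x y = entry s1 k x y by rewrite /entry a2.
split; last by rewrite /size_alive E2 rest_lt.
have [sep uvM] := separated_step sepM uS vS uv.
split.
- by rewrite /reads a2.
- by rewrite -A5 /alive a2 // a1.
- by move=> x y; rewrite ent E1 E1b.
- rewrite E2; apply: subset_trans sub; apply/subsetP => x.
  by rewrite inE => /andP[].
exists ([set u; v] |: M); rewrite E2; split=> //.
  by move=> x y; rewrite ent E1 /= M0 in_setU1; case: eqP.
by rewrite cardsU1 uvM; move: le drop; clear; lia.
Qed.

Lemma run_phase2 S0 m b s : invariant2 S0 m b s ->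
  let s' := run s [::] phase2 in
  invariant2 S0 m b s' /\ forall u v, ~ good e S0 (alive 4 s') u v.
Proof.
move=> Is.
pose test s ts := if pmap insub ts is [:: u; v]
  then [&& [&& u \in alive 4 s, v \in alive 4 s & e u v]
    & pot e S0 (alive 4 s) <= pot e S0 (rest e (alive 4 s) u v) + 350] else false.
have testP s1 u v : reflect (good e S0 (alive 4 s1) u v)
    (test s1 [:: u : nat; v : nat]).
  rewrite /test /= !valK; apply: (iffP andP) => [[/and3P[uS vS uv] le]|[uS vS uv le]].
    by split.
  by rewrite uS vS uv.
have [|||||I H] := @run_rounds n (invariant2 S0 m b) size_alive _ 2 test2
  (PSeq (mark 0 1 2 1) (kill 3 1 2)) test _ _ s.
- by move=> s1 [/reads_order].
- move=> i ts s1 /tuple2[u [v ->]] [rs A5 _ _ _].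
  by rewrite test2E // /test /= !valK A5.
- move=> i ts s1 /tuple2[u [v ->]] Is1 /testP.
  exact: step2.
- exact: Is.
- by rewrite /size_alive -[X in _ <= X]card_ord max_card.
split=> // u v /testP; apply/negP.
exact: H (tuples_val [:: u; v]).
Qed.

(** * The output and the final estimate *)

Lemma output_entry s k (x y : vertex G) : s 1 0 = 3 * n ^ 2 -> k < 3 ->
  nth 0 (output s) (k * n ^ 2 + x * n + y) = entry s k x y.
Proof.
move=> s0 k3; rewrite nth_mkseq /entry /pos -?addnA // s0.
have : x * n + y < n ^ 2.
  by have := ltn_ord x; have := ltn_ord y; rewrite -mulnn; nia.
by case: k k3 => [|[|[|]]] //; lia.
Qed.

Lemma dg_max_degree (S : {set vertex G}) x : dg e S x <= max_degree G.
Proof.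
apply: leq_trans (leq_bigmax x); apply: subset_leq_card.
by apply/subsetP => y; rewrite !inE => /andP[].
Qed.

Lemma program_correct : max_degree G <= 3 ->
  let s := run (input (encode_graph G)) [::] program in
  exists (M : {set {set vertex G}}) (y : {set vertex G} -> rat),
    encodes_solution (output s) M y /\
    [/\ induced_matching M, feasible_D y
      & (#|M|%:R >= 3%:R / 7%:R * \sum_(f in edges G) y f)%R].
Proof.
move=> deg3.
have deg (S : {set vertex G}) x : dg e S x <= 3.
  exact: leq_trans (dg_max_degree S x) deg3.
rewrite /program; cbn [run]; have := run_phase1.
set s1 := run _ _ phase1; case=> [[rs1 [M1 [Y [M10 Y1 sep1 touch leY]]]] irr].
have := run_copy rs1; set s2 := run s1 _ copy; case=> a2 A52.
have rs2 : reads s2 by rewrite /reads a2.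
have A42 : alive 4 s2 = alive 4 s1 by rewrite /alive a2.
have := run_weights rs2; set s3 := run s2 _ weights; case=> a3 E3.
have rs3 : reads s3 by rewrite /reads a3.
have A43 : alive 4 s3 = alive 4 s1 by rewrite /alive a3 // a2.
have A53 : alive 5 s3 = alive 4 s1 by rewrite -A52 /alive a3.
set S0 := alive 4 s1 in irr touch sep1 A52 A42 A43 A53.
have ent2 k x y : entry s2 k x y = entry s1 k x y by rewrite /entry a2.
(* With m = #|M1| the potential inequality starts as an equality, so 350 is charged only for edges
   of the second phase. *)
have I3 : invariant2 S0 #|M1| (entry s3 1) s3.
  split=> //; first by rewrite A43.
  by exists M1; rewrite A43; split=> // x y; rewrite E3 /= ent2 M10.
have := run_phase2 I3; set s4 := run s3 _ phase2.
case=> [[rs4 _ E4 sub4 [M [M0 [[Me ind] sep4] pot4]]] stuck].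
have := run_conclude rs4; set s5 := run s4 _ conclude; case=> s50 E5.
have S0_dg x : x \in S0 -> dg e S0 x \in [:: 0; 2; 3].
  move=> xS; have := deg S0 x; case dx: (dg e S0 x) => [|[|[|[|]]]] // _.
  have [|v [p [q [r [t red]]]]] := @leaf_reducible G S0 x _ xS dx.
    by move=> z _; apply: deg.
  by have := irr x v p q r t; rewrite red.
have noedge x y : x \in alive 4 s4 -> y \in alive 4 s4 -> ~~ e x y.
  move=> xS yS; apply/negP => xy.
  have [|u v a c uS vS aS cS du va cu uv ua vc ac|u [v g]] :=
    @good_exists _ e e_sym (@adj_irrefl G) S0 (alive 4 s4) _ sub4 _ x y xS yS xy.
  - by move=> z _; apply: deg.
  - have [|p [q [r [t red]]]] := @c4_reducible G S0 u v a c _ uS vS aS cS du va cu uv ua vc ac.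
      by move=> z _; apply: deg.
    by have := irr u v p q r t; rewrite red.
  exact: stuck g.
(* No edge remains, and isolated vertices carry no potential. *)
have pot0 : pot e S0 (alive 4 s4) = 0.
  apply: big1 => x xS; rewrite (_ : dg e (alive 4 s4) x = 0) //.
  by apply: eq_card0 => y; rewrite inE; apply/negP => /andP[yS]; apply/negP/noedge.
pose V f := value S0 Y f.
exists M, (fun f => (V f)%:R / 10%:R)%R; split.
  split=> [|u v|u v uv].
  - by rewrite size_mkseq s50.
  - by rewrite output_entry // E5 M0.
  rewrite !output_entry // !E5 /= E4; split=> //.
  congr (_%:R / _)%R; rewrite E3 A42 ent2 Y1 /=.
  rewrite in_edges in uv; case: ifP => [/andP[uS vS]|nS].
    by rewrite /V value_inside.
  by rewrite /V /value subUset !sub1set nS.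
have sumV (A : {set {set vertex G}}) :
    (\sum_(f in A) (V f)%:R / 10%:R = (\sum_(f in A) V f)%:R / 10%:R :> rat)%R.
  by rewrite -mulr_suml natr_sum.
split=> //; first split=> f fe.
- rewrite sumV ler_pdivlMr ?ltr0n // mul1r ler_nat.
  exact: value_cover.
- by rewrite divr_ge0 ?ler0n.
rewrite sumV.
have -> : (3%:R / 7%:R * ((\sum_(f in edges G) V f)%:R / 10%:R)
    = (3 * \sum_(f in edges G) V f)%:R / 70%:R :> rat)%R.
  by rewrite natrM; field.
rewrite ler_pdivrMr ?ltr0n // -natrM ler_nat.
(* 15 * sum V <= 150|Y| + pot(S0) <= 300|M1| + 350(|M| - |M1|) <= 350|M|; division by 5 gives the
   claim. *)
have := value_sum Y S0_dg; rewrite -/V; move: pot4 leY; rewrite pot0.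
by move: (\sum_(f in edges G) V f); clear; lia.
Qed.

End Run.

Theorem theorem2 :
  exists (c : cmd) (a k : nat), forall G : sgraph, max_degree G <= 3 ->
    exists (t : nat) (s : store)
           (M : {set {set vertex G}}) (y : {set vertex G} -> rat),
      [/\ exec c (input (encode_graph G)) t s,
          t <= a * bitsize (encode_graph G) ^ k + a
        & encodes_solution (output s) M y] /\
      [/\ induced_matching M,
          feasible_D y
        & (#|M|%:R >= 3%:R / 7%:R * \sum_(e in edges G) y e)%R].
Proof.
have [c [a [k run_c]]] := compile program_wf.
exists c, a, k => G deg3.
have [M [y [enc sol]]] := program_correct deg3.
have [|t [s [ex le ds]]] := run_c (input (encode_graph G)).
  apply: functional_extensionality => b; apply: functional_extensionality => j.
  by rewrite /data /input; case: b => [|[|[|[|b]]]].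
exists t, s, M, y; split=> //; split=> //; last first.
  have -> : output s = output (data s) by [].
  by rewrite ds.
apply: leq_trans le _; apply: leq_trans (leq_addr _ _).
(* The encoding has n^2 + 1 entries of at least one digit each, so a bound polynomial in n + 1 is
   polynomial in the input size. *)
have n_le : (Defs.order G).+1 <= bitsize (encode_graph G).
  apply: (@leq_trans (size (encode_graph G))).
    by rewrite size_encode_graph ltnS; case: (Defs.order G) => // m; rewrite leq_pmulr.
  by rewrite /bitsize -sum1_size; apply: leq_sum.
by case: k {run_c ex ds} => [|k]; rewrite ?expn0 // leq_mul2l leq_exp2r ?n_le ?orbT.
Qed.
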